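(* Let $k\ge 2$ be an integer, $1<p<2$ and $p'=p/(p-1)$. There exist constants $C,c>0$, independent of $f$, such that for every radial function $f=\sum_{n=0}^\infty f_n\chi_n$ on the free group $\mathbb{F}_k$ (with complex coefficients $f_n$) $$\|\lambda(f)\|_{p\to(p,\infty)}\le C\|f\|_{(p,p')},$$ and moreover, if $f\ge0$, then $$c\,\|f\|_{(p,p')}\le\|\lambda(f)\|_{p\to(p,\infty)}.$$
   Context: $\mathbb{F}_k$ is the free group on $k\ge2$ free generators. The length $|x|$ of $x\in\mathbb{F}_k$ is the number of letters in its reduced form as a word in the generators and their inverses. $\chi_n$ is the indicator function of the set of elements of length $n$. The group carries counting measure, so that $L^p=\ell^p(\mathbb{F}_k)$. For a function $f$ on $\mathbb{F}_k$, $\lambda(f)$ is the left convolution operator $\lambda(f)g=f*g$, $(f*g)(x)=\sum_y f(xy^{-1})g(y)$. For $1<p<\infty$ and $1\le s<\infty$, $\|h\|_{(p,s)}$ is the norm (up to equivalence) of the Lorentz space $L^{(p,s)}(\mathbb{F}_k)$, given by $\left(\sum_{j\ge1}j^{s/p-1}h^*(j)^s\right)^{1/s}$, where $h^*$ is the decreasing rearrangement of $|h|$. $L^{(p,\infty)}$ is weak $L^p$, i.e. the functions $h$ with $\sup_{t>0}t^p|\{x:|h(x)|>t\}|<\infty$, normed as the dual of $L^{(p',1)}$: $\|h\|_{(p,\infty)}=\sup_F|\langle h,\chi_F\rangle|/|F|^{1/p'}$ over finite nonempty sets $F$ with indicator function $\chi_F$. $\|T\|_{p\to(p,\infty)}$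 denotes the norm of $T$ as an operator from $L^p$ to $L^{(p,\infty)}$. Norms take the value $+\infty$ when the function is not in the space or the operator is not bounded. *)

(* Defs.v *)
From HB Require Import structures.
From mathcomp Require Import all_boot all_order all_algebra.
From mathcomp Require Import finmap complex.
From mathcomp Require Import boolp classical_sets functions reals ereal.
From mathcomp Require Import topology normedtype sequences esum numfun exp measure.

Set Implicit Arguments.
Unset Strict Implicit.
Unset Printing Implicit Defensive.

Import Order.TTheory GRing.Theory Num.Theory.

(* A letter (i, false) is the i-th generator, (i, true) its inverse. *)
Notation letter k := ('I_k * bool)%type.

Section FreeGroup.
Variable k : nat.
Implicit Types (a b : letter k) (u v w : seq (letter k)).

Definition inv_letter a : letter k := (a.1, ~~ a.2).

Definition reduced w : bool := sorted (fun a b => b != inv_letter a) w.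

Record free_group := FreeGroup { word :> seq (letter k); _ : reduced word }.

HB.instance Definition _ := [isSub for word].
HB.instance Definition _ := [Choice of free_group by <:].

Lemma word_reduced (x : free_group) : reduced x.
Proof. by case: x. Qed.

(* The reduced form of a :: w, for w reduced. *)
Definition push a w : seq (letter k) :=
  if w is b :: w' then if b == inv_letter a then w' else a :: w else [:: a].

Definition mul_word u v : seq (letter k) := foldr push v u.

Definition inv_word u : seq (letter k) := rev (map inv_letter u).

Lemma inv_letterK : involutive inv_letter.
Proof. by case=> i b; rewrite /inv_letter /= negbK. Qed.

Lemma reduced_push a w : reduced w -> reduced (push a w).
Proof.
case: w => [//|b w] /= bw; case: eqP => [_|/eqP ba]; first exact: path_sorted bw.
by rewrite /reduced /= ba.
Qed.

Lemma pushK a w : reduced w -> push a (push (inv_letter a) w) = w.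
Proof.
case: w => [|b w] /=; first by rewrite eqxx.
rewrite inv_letterK; case: (eqVneq b a) => [-> {b}|_ _]; last by rewrite /= eqxx.
by case: w => [//|c w] /= /andP[/negbTE->].
Qed.

Lemma push_cons a w : reduced (a :: w) -> push a w = a :: w.
Proof. by case: w => [//|b w] /= /andP[/negbTE->]. Qed.

Lemma reduced_mul u v : reduced v -> reduced (mul_word u v).
Proof. by move=> rv; elim: u => //= a u; exact: reduced_push. Qed.

Lemma reduced_inv u : reduced u -> reduced (inv_word u).
Proof.
rewrite /reduced /inv_word rev_sorted sorted_map; apply: sub_sorted => a b /=.
by apply: contra_neq => ->; rewrite !inv_letterK.
Qed.

Lemma mul_push a u w : reduced w ->
  mul_word (push a u) w = push a (mul_word u w).
Proof.
case: u => [//|b u] rw /=; case: eqP => [->|//].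
by rewrite pushK //; exact: reduced_mul.
Qed.

Lemma mul_wordA u v w : reduced w ->
  mul_word u (mul_word v w) = mul_word (mul_word u v) w.
Proof. by move=> rw; elim: u => //= a u ->; rewrite mul_push. Qed.

Lemma mul_word0 u : reduced u -> mul_word u [::] = u.
Proof.
elim: u => //= a u IH rau; rewrite IH ?push_cons //; exact: path_sorted rau.
Qed.

Lemma mul_invword u : reduced u -> mul_word (inv_word u) u = [::].
Proof.
elim: u => //= a u IH rau.
rewrite /inv_word /= rev_cons /mul_word foldr_rcons /= inv_letterK eqxx.
by apply: IH; exact: path_sorted rau.
Qed.

Definition fg_one : free_group := @FreeGroup [::] isT.
Definition fg_mul (x y : free_group) : free_group :=
  FreeGroup (reduced_mul x (word_reduced y)).
Definition fg_inv (x : free_group) : free_group :=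
  FreeGroup (reduced_inv (word_reduced x)).

Fact fg_mulA : associative fg_mul.
Proof. by move=> x y z; apply: val_inj => /=; exact/mul_wordA/word_reduced. Qed.

Fact fg_mul1 : left_id fg_one fg_mul.
Proof. by move=> x; exact: val_inj. Qed.

Fact fg_mulx1 : right_id fg_one fg_mul.
Proof. by move=> x; apply: val_inj; exact/mul_word0/word_reduced. Qed.

Fact fg_mulV : left_inverse fg_one fg_inv fg_mul.
Proof. by move=> x; apply: val_inj; exact/mul_invword/word_reduced. Qed.

Fact fg_mulxV : right_inverse fg_one fg_inv fg_mul.
Proof.
move=> x; have xK : fg_inv (fg_inv x) = x; last by rewrite -{1}xK fg_mulV.
apply: val_inj; rewrite /= /inv_word map_rev revK -map_comp.
by rewrite (eq_map (inv_letterK : inv_letter \o inv_letter =1 id)) map_id.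
Qed.

HB.instance Definition _ := isGroup.Build free_group
  fg_mulA fg_mul1 fg_mulx1 fg_mulV fg_mulxV.

Definition fg_length (x : free_group) : nat := size x.

End FreeGroup.

Local Open Scope classical_set_scope.
Local Open Scope ring_scope.

Section Norms.
Context {R : realType} {T : choiceType}.
Implicit Types (h : T -> R[i]) (p s : R).

Definition cabs (z : R[i]) : R := ComplexField.Normc.normc z.

Definition conj_exponent p : R := p / (p - 1).

Definition lp_norm p h : \bar R :=
  poweR (\esum_(x in [set: T]) (cabs (h x) `^ p)%:E) p^-1.

(* rearr h j is h^*(j), for j >= 1; it is +oo when h is unbounded. *)
Definition rearr h (j : nat) : \bar R :=
  ereal_inf [set t%:E | t in
    [set t : R | 0 <= t /\
      (counting [set x | (t < cabs (h x))%R] < (j%:R)%:E :> \bar R)%E]].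

Definition lorentz_norm p s h : \bar R :=
  poweR (\sum_(1 <= j <oo)
           ((j%:R `^ (s / p - 1))%:E * poweR (rearr h j) s))%E s^-1.

(* Weak L^p normed as the dual of L^(p',1); it is +oo outside weak L^p. *)
Definition weak_norm p h : \bar R :=
  ereal_sup [set (cabs (\sum_(x <- F) h x)
                  / (#|` F|%:R `^ (conj_exponent p)^-1))%:E
            | F in [set F : {fset T} | F != fset0]].

Definition abs_summable h : Prop := summable [set: T] (fun x => (cabs (h x))%:E).

(* The sum of an absolutely summable family. *)
Definition real_sum (a : T -> R) : R :=
  fine (esum [set: T] (fun x => (a x)%:E)^\+%E
        - esum [set: T] (fun x => (a x)%:E)^\-%E).

Definition complex_sum h : R[i] :=
  Complex (real_sum (fun x => complex.Re (h x)))
          (real_sum (fun x => complex.Im (h x))).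

(* Norm from L^p to L^(p,oo) of the operator A with domain dom; it is +oo when
   dom does not contain L^p. *)
Definition opnorm_weak p (dom : set (T -> R[i]))
    (A : (T -> R[i]) -> (T -> R[i])) : \bar R :=
  ereal_inf [set M%:E | M in
    [set M : R | 0 <= M /\
      forall g, (lp_norm p g < +oo)%E ->
        dom g /\ (weak_norm p (A g) <= M%:E * lp_norm p g)%E]].

End Norms.

Section Convolution.
Context {R : realType} {G : groupType}.
Implicit Types (f g : G -> R[i]).

Definition conv_term f g (x y : G) : R[i] := f (x * y^-1)%g * g y.

Definition conv_dom f : set (G -> R[i]) :=
  [set g | forall x, abs_summable (conv_term f g x)].

Definition conv f g : G -> R[i] := fun x => complex_sum (conv_term f g x).

Definition lambda_norm p f : \bar R := opnorm_weak p (conv_dom f) (conv f).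

End Convolution.

Section Radial.
Context {R : realType} {k : nat}.

Definition chi (n : nat) (x : free_group k) : R[i] := (fg_length x == n)%:R.

(* The function \sum_n a n * chi n; at x only the term n = |x| is nonzero. *)
Definition radial (a : nat -> R[i]) (x : free_group k) : R[i] :=
  a (fg_length x).

Lemma radialE (a : nat -> R[i]) (x : free_group k) (N : nat) :
  (fg_length x < N)%N -> radial a x = \sum_(n < N) a n * chi n x.
Proof.
move=> xN; rewrite (bigD1 (Ordinal xN)) //= /chi eqxx mulr1 big1 ?addr0 // => i.
by rewrite -val_eqE /= eq_sym => /negbTE->; rewrite mulr0.
Qed.

End Radial.

(* Main.v *)
Require Import Defs.
From HB Require Import structures.
From mathcomp Require Import all_boot all_order all_algebra complex reals ereal.
From mathcomp Require Import monoid finmap.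
From mathcomp Require Import boolp classical_sets functions cardinality fsbigop.
From mathcomp Require Import topology normedtype sequences esum numfun exp.
From mathcomp Require Import measure hoelder ring lra zify.

(** Put [q = 2 k - 1] and [r = p / (p - 1)], so that [r > 2]; a sphere of radius
    [n] has between [q ^ n] and [2 q ^ n] elements.

    Norms.  For [f = \sum_n f_n chi_n], the r-th power of the Lorentz norm is
    comparable with [\sum_n (|f_n| q ^ (n / p)) ^ r]: cut the series in [j] into
    the blocks [q ^ n <= j < q ^ (n + 1)]; on such a block the rearrangement is at
    least [|f_(n + 1)|] and at most the supremum of the [|f_l|] with [l >= n]
    ([coef_sum_le_lorentz], [lorentz_le_coef_sum]).

    Upper bound.  One has to bound [\sum_(x in X) \sum_y |f (x y^-1)| |g y|] by
    [|X| ^ (1 / r)] times the l^p norm of [g], for finite sets [X].  Make the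
    group a rooted tree, the parent of a nonempty reduced word being the word
    without its first letter.  If [z] is the longest common suffix of [x = u z] and
    [y = v z], then [|x y^-1| = |u| + |v|] ([fg_length_mulV]), and so the sum is at
    most [\sum_(i, j) |f_(i + j)| \sum_z N_i(z) G_j(z)], where [N_i(z)] counts the
    elements of [X] whose [i]-th ancestor is [z] and [G_j(z)] sums [|g|] over the
    [y] whose [j]-th ancestor is [z].  By Hoelder's inequality on the at most
    [2 q ^ j] such [y], the sum over [z] for given [j] loses [q ^ (j / r)] against
    the weight [q ^ (- j / p)]: the series in [j] is geometric ([bilinear_sum]).
    There remains, for each [j], the inequality
    [\sum_z (\sum_i c_i q ^ (- i / p) N_i(z)) ^ r <= C |X| \sum_i c_i ^ r]
    ([fibre_sum]), which only uses [N_i(z) <= 2 q ^ i] and [\sum_z N_i(z) <= |X|].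
    To get it, telescope the r-th powers of the partial sums in [i]: the increments
    are at most [r c_i q ^ (- i / p) N_i(z) S_(i + 1) ^ (r - 1)] by the tangent
    inequality, and [S_(i + 1)] is at most [2 q ^ (i / r)] times the sum of the
    [c_l q ^ (- (i - l) / r)] with [l <= i].  These discounted sums are bounded
    on l^r, and the powers of [q] cancel.

    Lower bound.  For [f >= 0], apply the operator to the function equal to
    [(f_(N - l) q ^ (N - l)) ^ (r - 1)] on the sphere of radius [l <= N], and test
    the result on the sphere of radius [N].  Any bound [M] of the operator then
    satisfies [\sum_(n <= N) (f_n q ^ (n / p)) ^ r <= (2 M) ^ r]
    ([coef_sum_le_opnorm]). *)

Set Implicit Arguments.
Unset Strict Implicit.
Unset Printing Implicit Defensive.

Import Order.TTheory GRing.Theory Num.Theory.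

(** * Reduced words and the tree of suffixes *)

Section Words.
Variable k : nat.
Implicit Types (u v w z : seq (letter k)) (x y : free_group k).

Lemma mul_word_cat u w : reduced (u ++ w) -> mul_word u w = u ++ w.
Proof.
elim: u => //= a u IH r; rewrite IH ?push_cons //; exact: path_sorted r.
Qed.

Lemma reduced_catl u w : reduced (u ++ w) -> reduced u.
Proof. by rewrite /reduced; case: u => //= a u; rewrite cat_path => /andP[]. Qed.

Lemma reduced_catr u w : reduced (u ++ w) -> reduced w.
Proof.
by rewrite /reduced; elim: u => //= a u IH /path_sorted /IH.
Qed.

Lemma reduced_rcons_cons u w (a b : letter k) :
  reduced (rcons u a ++ b :: w) =
  [&& reduced (rcons u a), b != inv_letter a & reduced (b :: w)].
Proof.
rewrite /reduced; case: u => [|c u] /=; first by [].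
by rewrite cat_path last_rcons.
Qed.

(** If [x = u y] without cancellation, then [x y^-1 = u]. *)
Lemma fg_mul_cat x y u :
  word x = u ++ word y -> fg_length (x * y^-1)%g = size u.
Proof.
move=> xuy; have ru : reduced u.
  by apply: (@reduced_catl u (word y)); rewrite -xuy; exact: word_reduced.
have -> : x = (FreeGroup ru * y)%g.
  apply: val_inj => /=; rewrite xuy -mul_word_cat //.
  by rewrite -xuy; exact: word_reduced.
by rewrite mulgK.
Qed.

(** The longest common suffix [z] of [u] and [v]: the remaining prefixes do
    not end with the same letter. *)
Lemma common_suffix u v : exists u' v' z, [/\ u = u' ++ z, v = v' ++ z &
  forall u1 v1 a, ~ (u' = rcons u1 a /\ v' = rcons v1 a)].
Proof.
elim/last_ind: u v => [|u a IH] v.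
  exists [::], v, [::]; split=> [||u1 v1 b []]; rewrite ?cats0 //.
  by case: u1.
case/lastP: v => [|v b].
  exists (rcons u a), [::], [::]; split=> [||u1 v1 b [_]]; rewrite ?cats0 //.
  by case: v1.
have [->{a}|nab] := eqVneq a b.
  have [u' [v' [z [-> -> H]]]] := IH v.
  by exists u', v', (rcons z b); rewrite !rcons_cat.
exists (rcons u a), (rcons v b), [::]; split=> [||u1 v1 c []]; rewrite ?cats0 //.
by move=> /rcons_inj[_ ac] /rcons_inj[_ bc]; move: nab; rewrite ac bc eqxx.
Qed.

(** If [z] is the longest common suffix of [x = u z] and [y = v z], then
    [x y^-1 = u v^-1] without cancellation; here [i = |u|] and [j = |v|]. *)
Lemma fg_length_mulV x y : exists i j : nat,
  [/\ (i <= size (word x))%N, (j <= size (word y))%N,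
      drop i (word x) = drop j (word y) & fg_length (x * y^-1)%g = (i + j)%N].
Proof.
have [u [v [z [xE yE uv]]]] := common_suffix (word x) (word y).
exists (size u), (size v); rewrite xE yE !drop_size_cat // !size_cat.
split => //; try exact: leq_addr.
have ru : reduced u by apply: (@reduced_catl u z); rewrite -xE word_reduced.
have rv : reduced v by apply: (@reduced_catl v z); rewrite -yE word_reduced.
have rz : reduced z by apply: (@reduced_catr u z); rewrite -xE word_reduced.
have -> : x = (FreeGroup ru * FreeGroup rz)%g.
  apply: val_inj => /=; rewrite mul_word_cat -xE //; exact: word_reduced.
have -> : y = (FreeGroup rv * FreeGroup rz)%g.
  apply: val_inj => /=; rewrite mul_word_cat -yE //; exact: word_reduced.
rewrite mulgKA /fg_length /= mul_word_cat.
  by rewrite size_cat /inv_word size_rev size_map.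
case/lastP: u ru {xE} uv => [|u a] ru uv; first exact: reduced_inv.
case/lastP: v rv {yE} uv => [|v b] rv uv; first by rewrite cats0.
have := reduced_inv rv; rewrite /inv_word map_rcons rev_rcons => ri.
rewrite reduced_rcons_cons ru ri andbT /=.
apply/eqP => /(inv_inj (@inv_letterK k)) ba.
by apply: (uv u v a); rewrite ba.
Qed.

(** The reduced words having a given word [w] as their [n]-th ancestor, the
    parent of a nonempty word being the word without its first letter. *)
Fixpoint descendants n w : seq (seq (letter k)) :=
  if n is n'.+1 then
    flatten [seq [seq a :: v | a <- enum {: letter k} & reduced (a :: v)]
            | v <- descendants n' w]
  else [:: w].

Lemma mem_descendants n w v : reduced w ->
  (v \in descendants n w) =
    [&& reduced v, (n <= size v)%N & drop n v == w].
Proof.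
move=> rw; elim: n v => [|n IH] v.
  rewrite /= inE drop0; case: eqP => [->|]; by rewrite ?rw ?andbF.
apply/flatten_mapP/idP => [[u]|].
  rewrite IH => /and3P[ru nu /eqP dw] /mapP[a]; rewrite mem_filter => /andP[ra _] ->.
  by rewrite ra /= ltnS nu dw eqxx.
case: v => [|a v]; first by rewrite ltn0 andbF.
move=> /and3P[rv nv dv]; exists v.
  by rewrite IH (@reduced_catr [:: a] v rv) dv andbT.
by apply/mapP; exists a; rewrite // mem_filter rv mem_enum.
Qed.

Lemma descendants_uniq n w : uniq (descendants n w).
Proof.
elim: n => //= n IH; apply: allpairs_uniq_dep => //.
  by move=> v _; rewrite filter_uniq ?enum_uniq.
by move=> [a1 v1] [a2 v2] _ _ [] -> ->.
Qed.

(** A reduced word has [2 k - 1] children, except the empty word, which has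
    [2 k]. *)
Lemma size_descendants_step w : reduced w ->
  (k.*2.-1 <= size [seq a <- enum {: letter k} | reduced (a :: w)])%N.
Proof.
move=> rw; rewrite size_filter -sum1_count big_enum_cond /= sum1_card.
have cT : #|{: letter k}| = k.*2 by rewrite card_prod card_ord card_bool muln2.
case: w rw => [|b w] rw.
  rewrite -cT; apply: leq_trans (leq_pred _) _.
  exact/subset_leq_card/fintype.subsetP.
rewrite -cT -(cardC1 (inv_letter b)); apply/subset_leq_card/fintype.subsetP => a.
rewrite !inE /reduced /= => ab; apply/andP; split => //.
by apply: contra_neq ab => ->; rewrite inv_letterK.
Qed.

Lemma size_descendants_stepE b w : reduced (b :: w) ->
  size [seq a <- enum {: letter k} | reduced (a :: b :: w)] = k.*2.-1.
Proof.
move=> rw; rewrite size_filter -sum1_count big_enum_cond /= sum1_card.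
have cT : #|{: letter k}| = k.*2 by rewrite card_prod card_ord card_bool muln2.
rewrite -cT -(cardC1 (inv_letter b)); apply: eq_card => a.
rewrite !inE /reduced /= -topredE /=; move: rw; rewrite /reduced /= => ->.
by rewrite andbT; congr negb; apply/eqP/eqP => ->; rewrite inv_letterK.
Qed.

Lemma size_descendantsS n w : reduced w -> size (descendants n.+1 w) =
  (\sum_(v <- descendants n w)
     size [seq a <- enum {: letter k} | reduced (a :: v)])%N.
Proof.
move=> rw /=; rewrite size_flatten /shape -map_comp sumnE big_map.
by apply: eq_bigr => v _ /=; rewrite size_map.
Qed.

Lemma size_descendants_ge n w : reduced w ->
  (k.*2.-1 ^ n <= size (descendants n w))%N.
Proof.
move=> rw; elim: n => // n IH; rewrite size_descendantsS //.
apply: (@leq_trans (\sum_(v <- descendants n w) k.*2.-1)%N).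
  by rewrite big_const_seq count_predT iter_addn_0 expnS leq_mul2l IH orbT.
rewrite big_seq [leqRHS]big_seq; apply: leq_sum => v.
by rewrite mem_descendants // => /andP[rv _]; exact: size_descendants_step.
Qed.

Lemma size_descendants_le n w : (0 < k)%N -> reduced w ->
  (size (descendants n w) <= 2 * k.*2.-1 ^ n)%N.
Proof.
move=> k0 rw; case: n => // n; elim: n => [|n IH].
  rewrite size_descendantsS //= big_seq1 expn1 size_filter.
  apply: leq_trans (count_size _ _) _.
  by rewrite -cardE card_prod card_ord card_bool; lia.
rewrite size_descendantsS //.
apply: (@leq_trans (\sum_(v <- descendants n.+1 w) k.*2.-1)%N).
  rewrite big_seq [leqRHS]big_seq; apply: leq_sum => v.
  rewrite mem_descendants //; case: v => [|b v]; first by rewrite ltn0 andbF.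
  by case/andP=> rv _; rewrite size_descendants_stepE.
rewrite big_const_seq count_predT iter_addn_0 expnS mulnCA leq_mul2l.
by rewrite IH orbT.
Qed.

End Words.

Local Open Scope classical_set_scope.
Local Open Scope ring_scope.

(** * Inequalities for powers *)

Section Inequalities.
Context {R : realType}.
Implicit Types (p r q b t : R).

Lemma ler_powR2 (r x y : R) : 0 <= r -> 0 <= x -> x <= y -> x `^ r <= y `^ r.
Proof.
by move=> r0 x0 xy; apply: ge0_ler_powR; rewrite ?nnegrE // (le_trans x0).
Qed.

Lemma powRK (r x : R) : r != 0 -> 0 <= x -> (x `^ r) `^ r^-1 = x.
Proof. by move=> r0 x0; rewrite -powRrM mulfV // powRr1. Qed.

Lemma powRVK (r x : R) : r != 0 -> 0 <= x -> (x `^ r^-1) `^ r = x.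
Proof. by move=> r0 x0; rewrite -powRrM mulVf // powRr1. Qed.

Lemma powR_exprn (x r : R) n : 0 <= x -> (x ^+ n) `^ r = (x `^ r) ^+ n.
Proof.
move=> x0; elim: n => [|n IH]; first by rewrite !expr0 powR1.
by rewrite !exprS powRM ?exprn_ge0 // IH.
Qed.

Lemma hoelder_sum (I : Type) (s : seq I) (P : pred I) (a c : I -> R) p r :
  0 < p -> 0 < r -> p^-1 + r^-1 = 1 ->
  (forall i, 0 <= a i) -> (forall i, 0 <= c i) ->
  \sum_(i <- s | P i) a i * c i <=
  (\sum_(i <- s | P i) a i `^ p) `^ p^-1 * (\sum_(i <- s | P i) c i `^ r) `^ r^-1.
Proof.
move=> p0 r0 pr a0 c0; rewrite -!(big_filter s P); set s' := [seq i <- s | P i].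
elim: s' => [|i l IH]; first by rewrite !big_nil !powR0 ?mul0r ?invr_eq0 ?gt_eqF.
rewrite !big_cons.
have S0 (f : I -> R) (u : R) : 0 <= \sum_(i <- l) f i `^ u.
  by apply: sumr_ge0 => *; exact: powR_ge0.
move: IH; set SA := \sum_(j <- l) a j `^ p; set SC := \sum_(j <- l) c j `^ r.
have AE := powRVK (lt0r_neq0 p0) (S0 a p).
have CE := powRVK (lt0r_neq0 r0) (S0 c r).
rewrite -/SA -/SC in AE CE.
move: AE CE (powR_ge0 SA p^-1) (powR_ge0 SC r^-1).
move: (SA `^ p^-1) (SC `^ r^-1) => A C AE CE A0 C0 IH.
have := hoelder2 (a0 i) A0 (c0 i) C0 p0 r0 pr.
by rewrite AE CE; apply: le_trans; rewrite lerD2l.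
Qed.

Section Conjugate.
Variables (p r : R).
Hypotheses (p0 : 0 < p) (r0 : 0 < r) (pr : p^-1 + r^-1 = 1).

(* Read from the context by [field]. *)
Let r_neq0 : r != 0. Proof. by rewrite gt_eqF. Qed.
Let p_neq0 : p != 0. Proof. by rewrite gt_eqF. Qed.

Lemma conj_mulr : (r - 1) * p = r.
Proof.
have -> : p = r / (r - 1).
  have rp : p^-1 = (r - 1) / r by rewrite -(addrK r^-1 p^-1) pr; field.
  by rewrite -(invrK p) rp invf_div.
have [r1|r1] := eqVneq (r - 1) 0; last by rewrite mulrC divfK.
move: pr; have -> : r = 1 by lra.
rewrite invr1 => /(canRL (addrK _)); rewrite subrr => /eqP.
by rewrite invr_eq0 (negbTE p_neq0).
Qed.

Lemma conj_gt1 : 1 < r.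
Proof.
have /(congr1 (fun x => 0 < x)) := conj_mulr.
by rewrite r0 (pmulr_lgt0 _ p0) subr_gt0.
Qed.

Lemma conj_div : r / p = r - 1.
Proof. by rewrite -{1}conj_mulr mulfK. Qed.

(** The tangent inequality of the convex function [x |-> x ^ r]. *)
Lemma powR_tangent (s t : R) : 0 <= s -> 0 <= t ->
  (s + t) `^ r <= s `^ r + r * (t * (s + t) `^ (r - 1)).
Proof.
move=> s0 t0; set x := s + t; have x0 : 0 <= x by exact: addr_ge0.
have := @conjugate_powR R (x `^ (r - 1)) s p r (powR_ge0 _ _) s0 p0 r0 pr.
rewrite -powRrM conj_mulr => H.
have xE : x `^ r = x * x `^ (r - 1) by rewrite mulr_powRB1.
have pE : p^-1 = 1 - r^-1 by rewrite -pr addrK.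
have := ler_wpM2l (ltW r0) H; rewrite pE mulrDr.
have -> : r * (x `^ r * (1 - r^-1)) = r * x `^ r - x `^ r by field.
have -> : r * (s `^ r / r) = s `^ r by field.
rewrite xE; set y := x `^ (r - 1) => h.
have hx : r * (x * y) = r * (y * s) + r * (t * y) by rewrite /x; ring.
by rewrite hx in h; lra.
Qed.

(** Convexity of [x |-> x ^ r] between [x] and [y / (1 - t)], with weights
    [t] and [1 - t]. *)
Lemma powR_convex2 (t x y : R) : 0 < t -> t < 1 -> 0 <= x -> 0 <= y ->
  (t * x + y) `^ r <= t * x `^ r + (1 - t) `^ (1 - r) * y `^ r.
Proof.
move=> t0 t1 x0 y0; have u0 : 0 < 1 - t by rewrite subr_gt0.
set u := 1 - t in u0 *.
have rpV : r^-1 + p^-1 = 1 by rewrite addrC.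
have := @hoelder2 R (t `^ r^-1 * x) (u `^ (- p^-1) * y) (t `^ p^-1) (u `^ p^-1)
  r p _ _ _ _ r0 p0 rpV.
rewrite !mulr_ge0 ?powR_ge0 // => /(_ isT isT isT isT).
rewrite !powRVK ?(ltW t0) ?(ltW u0) // {4}/u subrKC powR1 mulr1.
rewrite !(powRM _ (powR_ge0 _ _)) // (powRVK _ (ltW t0)) // -(powRrM u) mulNr.
rewrite [p^-1 * r]mulrC conj_div opprB.
rewrite mulrAC -powRD ?(lt0r_neq0 t0) ?implybT // rpV powRr1 ?(ltW t0) //.
rewrite mulrAC -powRD ?(lt0r_neq0 u0) ?implybT // addNr powRr0 mul1r => H.
have := ler_powR2 (ltW r0) _ H; rewrite powRVK //; last first.
  by rewrite addr_ge0 ?mulr_ge0 ?powR_ge0 ?(ltW t0).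
by apply; rewrite addr_ge0 // mulr_ge0 ?(ltW t0).
Qed.

End Conjugate.
End Inequalities.

(** * A bilinear inequality for fibres of exponential growth *)

Section Fibres.
Context {R : realType}.
Variables (p r : R).
Hypotheses (p0 : 0 < p) (r0 : 0 < r) (pr : p^-1 + r^-1 = 1).

(** The geometrically discounted sum [\sum_(l <= n) t ^+ (n - l) * c l]. *)
Fixpoint discount (t : R) (c : nat -> R) n : R :=
  if n is n'.+1 then t * discount t c n' + c n else c 0%N.

Lemma discount_ge0 t c n : 0 <= t -> (forall i, 0 <= c i) -> 0 <= discount t c n.
Proof.
by move=> t0 c0; elim: n => //= n IH; rewrite addr_ge0 // mulr_ge0.
Qed.

Lemma discount_ge t c n : 0 <= t -> (forall i, 0 <= c i) -> c n <= discount t c n.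
Proof.
by move=> t0 c0; case: n => //= n; rewrite lerDr mulr_ge0 // discount_ge0.
Qed.

(** Discounting is bounded on l^r: by convexity, the [r]-th power of
    [discount t c m.+1] is at most [t] times the one of [discount t c m] plus a
    multiple of [c m.+1 ^ r]. *)
Lemma discount_sum t c m : 0 < t -> t < 1 -> (forall i, 0 <= c i) ->
  \sum_(i < m) discount t c i `^ r <=
  (1 - t) `^ (1 - r) / (1 - t) * \sum_(i < m) c i `^ r.
Proof.
move=> t0 t1 c0; have u0 : 0 < 1 - t by rewrite subr_gt0.
case: m => [|m]; first by rewrite !big_ord0 mulr0.
set L := (1 - t) `^ (1 - r).
rewrite mulrAC ler_pdivlMr // mulrC.
suff : (1 - t) * \sum_(i < m.+1) discount t c i `^ r + t * discount t c m `^ r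
    <= L * \sum_(i < m.+1) c i `^ r.
  by apply: le_trans; rewrite lerDl mulr_ge0 ?powR_ge0 // ltW.
elim: m => [|m IH].
  rewrite !big_ord_recr !big_ord0 /= !add0r -mulrDl subrK mul1r.
  rewrite ler_peMl ?powR_ge0 // /L -(opprB r 1) powRN invf_ge1 ?powR_gt0 //.
  rewrite -[leRHS](powRr0 (1 - t)) ger_powR ?u0 ?gerBl ?ltW //.
  by rewrite subr_gt0; exact: conj_gt1 p0 r0 pr.
rewrite big_ord_recr [in leRHS]big_ord_recr.
have := powR_convex2 p0 r0 pr t0 t1 (discount_ge0 m (ltW t0) c0) (c0 m.+1).
rewrite -/L /= => H; rewrite mulrDr [leRHS]mulrDr -addrA -mulrDl subrK mul1r.
lra.
Qed.

(** In what follows [b ^ r = q], so that [q ^ (1 / p) = q / b]: the weights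
    [q ^ (- i / p)] are the integer powers [(b / q) ^+ i]. *)
Variables (q b D K : R).
Hypotheses (b1 : 1 < b) (bq : b `^ r = q) (D0 : 0 <= D).

Let b0 : 0 < b. Proof. exact: lt_trans b1. Qed.
Let q0 : 0 < q. Proof. by rewrite -bq powR_gt0. Qed.
Let t0 : 0 < b^-1. Proof. by rewrite invr_gt0. Qed.
Let t1 : b^-1 < 1. Proof. by rewrite invf_lt1. Qed.

Let weight_gt0 i : 0 < (b / q) ^+ i.
Proof. by rewrite exprn_gt0 // divr_gt0. Qed.

Let weightE i x : ((b / q) ^+ i * (q ^+ i * x) = b ^+ i * x).
Proof. by rewrite mulrA -exprMn divfK ?gt_eqF. Qed.

Section Pointwise.
Variables (c x : nat -> R).
Hypotheses (c0 : forall i, 0 <= c i) (x0 : forall i, 0 <= x i)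
  (xD : forall i, x i <= D * q ^+ i).

Let S m := \sum_(i < m) c i * ((b / q) ^+ i * x i).

Let S_ge0 m : 0 <= S m.
Proof.
by apply: sumr_ge0 => i _; rewrite mulr_ge0 // mulr_ge0 // ltW.
Qed.

(** As [(b / q) ^+ i * x i <= D * b ^+ i], the partial sums are controlled by
    the discounted sums of [c]. *)
Lemma partial_discount m : S m.+1 <= D * (b ^+ m * discount b^-1 c m).
Proof.
have H i : c i * ((b / q) ^+ i * x i) <= D * (b ^+ i * c i).
  rewrite mulrCA [leRHS](_ : _ = c i * ((b / q) ^+ i * (D * q ^+ i))).
    by rewrite mulrCA ler_wpM2l // ler_wpM2l // ltW.
  by rewrite -weightE; ring.
elim: m => [|m IH]; first by rewrite /S big_ord1 (H 0%N).
rewrite /S big_ord_recr /=; apply: le_trans (lerD IH (H m.+1)) _.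
by rewrite -mulrDr ler_wpM2l // mulrDr {2}exprSr -(mulrA _ b) mulVKf // gt_eqF.
Qed.

Lemma telescope_powR m : S m `^ r <=
  r * \sum_(i < m) c i * ((b / q) ^+ i * x i) * S i.+1 `^ (r - 1).
Proof.
elim: m => [|m IH]; first by rewrite /S !big_ord0 powR0 ?mulr0 // gt_eqF.
have SE : S m.+1 = S m + c m * ((b / q) ^+ m * x m) by rewrite /S big_ord_recr.
rewrite big_ord_recr /= mulrDr {1}SE.
apply: le_trans (powR_tangent p0 r0 pr (S_ge0 m) _) _.
  by rewrite mulr_ge0 // mulr_ge0 // ltW.
by rewrite -SE lerD2r.
Qed.

Lemma fibre_pointwise m : S m `^ r <=
  r * D `^ (r - 1) * \sum_(i < m) x i * discount b^-1 c i `^ r.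
Proof.
apply: le_trans (telescope_powR m) _; rewrite -[leRHS]mulrA ler_wpM2l ?(ltW r0) // mulr_sumr.
have r1 : 0 <= r - 1 by rewrite subr_ge0 ltW // (conj_gt1 p0 r0 pr).
apply: ler_sum => i _; set d := discount _ _ _.
have d0 : 0 <= d by apply: discount_ge0 => //; exact: ltW.
have cd : c i <= d by apply: discount_ge => //; exact: ltW.
have /(ler_powR2 r1 (S_ge0 _)) := partial_discount i; rewrite -/d.
rewrite powRM ?mulr_ge0 ?exprn_ge0 ?(ltW b0) // powRM ?exprn_ge0 ?(ltW b0) //.
move=> SD; apply: le_trans (ler_wpM2l _ SD) _.
  by rewrite mulr_ge0 // mulr_ge0 // ltW.
(* The powers of [q] cancel exactly, since [b * b ^ (r - 1) = q]. *)
have bE : (b / q) ^+ i * (b ^+ i) `^ (r - 1) = 1.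
  rewrite (powR_exprn _ _ (ltW b0)) -exprMn.
  by rewrite mulrAC (mulr_powRB1 (ltW b0) r0) bq divff ?expr1n // gt_eqF.
rewrite [leLHS](_ : _ = D `^ (r - 1) * (x i * (c i * d `^ (r - 1))) *
   ((b / q) ^+ i * (b ^+ i) `^ (r - 1))); last by ring.
rewrite bE mulr1 ler_wpM2l ?powR_ge0 // ler_wpM2l // -(mulr_powRB1 d0 r0).
by rewrite ler_wpM2r // powR_ge0.
Qed.
End Pointwise.

Section Bilinear.
Context {T : Type}.
Variables (Z : seq T) (X : nat -> T -> R).
Hypotheses (X0 : forall i z, 0 <= X i z) (XD : forall i z, X i z <= D * q ^+ i)
  (XK : forall i, \sum_(z <- Z) X i z <= K).

(** The constant of [fibre_sum]; [(1 - b^-1) ^ (1 - r) / (1 - b^-1)] is the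
    one of [discount_sum] for the ratio [b^-1]. *)
Definition fibre_const : R :=
  r * D `^ (r - 1) * ((1 - b^-1) `^ (1 - r) / (1 - b^-1)).

Lemma fibre_const_ge0 : 0 <= fibre_const.
Proof.
by rewrite mulr_ge0 ?divr_ge0 ?mulr_ge0 ?powR_ge0 ?subr_ge0 ?(ltW r0) ?(ltW t1).
Qed.

(** For nonnegative [X i] with [X i <= D q ^ i] and [\sum_z X i z <= K], the map
    [c |-> \sum_i c i q ^ (- i / p) X i] is bounded from l^r to l^r, with norm at
    most a multiple of [K ^ (1 / r)]. *)
Lemma fibre_sum (c : nat -> R) m : (forall i, 0 <= c i) ->
  \sum_(z <- Z) (\sum_(i < m) c i * ((b / q) ^+ i * X i z)) `^ r <=
  fibre_const * K * \sum_(i < m) c i `^ r.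
Proof.
move=> c0.
apply: (@le_trans _ _ (\sum_(z <- Z) (r * D `^ (r - 1) *
    \sum_(i < m) X i z * discount b^-1 c i `^ r))).
  apply: ler_sum => z _.
  exact: (fibre_pointwise c0 (fun i => X0 i z) (fun i => XD i z) m).
rewrite -mulr_sumr exchange_big /=.
have C0 : 0 <= r * D `^ (r - 1) by rewrite mulr_ge0 ?powR_ge0 // ltW.
have K0 : 0 <= K by apply: le_trans (XK 0); apply: sumr_ge0.
apply: (@le_trans _ _ (r * D `^ (r - 1) * (K *
   \sum_(i < m) discount b^-1 c i `^ r))).
  rewrite ler_wpM2l // mulr_sumr; apply: ler_sum => i _.
  by rewrite -mulr_suml ler_wpM2r // powR_ge0.
rewrite /fibre_const -[leRHS]mulrA -[leRHS]mulrA ler_wpM2l //.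
by rewrite [leRHS]mulrCA ler_wpM2l //; exact: discount_sum.
Qed.

Variables (G H : nat -> T -> R) (N : R).
Hypotheses (H0 : forall j z, 0 <= H j z)
  (GH : forall j z, G j z <= (D * q ^+ j) `^ r^-1 * H j z `^ p^-1)
  (HN : forall j, \sum_(z <- Z) H j z <= N) (r2 : 2 < r).

(** The constant of [bilinear_sum]; the denominator sums the geometric series
    of ratio [b ^+ 2 / q = q ^ (2 / r - 1)], which converges as [2 < r]. *)
Definition bilinear_const : R :=
  D `^ r^-1 * fibre_const `^ r^-1 / (1 - b ^+ 2 / q).

Let ratio_ge0 : 0 <= b ^+ 2 / q.
Proof. by rewrite divr_ge0 ?exprn_ge0 // ltW. Qed.

Let ratio_lt1 : b ^+ 2 / q < 1.
Proof.
rewrite ltr_pdivrMr // mul1r -bq -(powR_mulrn _ (ltW b0)).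
have lb : 0 < ln b by rewrite ln_gt0.
rewrite /powR gt_eqF // ltr_expR ltr_pM2r //.
Qed.

Lemma bilinear_const_ge0 : 0 <= bilinear_const.
Proof.
rewrite /bilinear_const divr_ge0 ?mulr_ge0 ?powR_ge0 // subr_ge0 ltW //.
Qed.

Lemma geometric_le (t : R) m : 0 <= t -> t < 1 ->
  \sum_(j < m) t ^+ j <= (1 - t)^-1.
Proof.
move=> ht0 ht1; have u0 : 0 < 1 - t by rewrite subr_gt0.
rewrite -[leRHS]mul1r ler_pdivlMr // mulrC.
have -> : (1 - t) * \sum_(j < m) t ^+ j = 1 - t ^+ m.
  by rewrite -[1 in RHS](expr1n _ m) subrXX; congr (_ * _); apply: eq_bigr => j _;
    rewrite expr1n mul1r.
by rewrite gerBl exprn_ge0.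
Qed.

(** The bilinear form attached to a kernel [a (i + j) * q ^ (- (i + j) / p)].
    For fixed [j], Hoelder's inequality in [z] reduces it to [fibre_sum]; the
    bound obtained decays geometrically in [j], because [G j] grows only like
    [q ^ (j / r)] and [1 / r < 1 / p].  When [G j z] sums a function over the
    descendants of [z] of order [j], [H j z] sums its [p]-th power. *)
Lemma bilinear_sum (a : nat -> R) m : (forall n, 0 <= a n) ->
  \sum_(j < m) \sum_(i < m) a (i + j)%N * (b / q) ^+ (i + j) *
     \sum_(z <- Z) X i z * G j z <=
  bilinear_const * K `^ r^-1 * N `^ p^-1 *
    (\sum_(n < m.*2) a n `^ r) `^ r^-1.
Proof.
move=> a0.
have K0 : 0 <= K by apply: le_trans (XK 0); apply: sumr_ge0.
have N0 : 0 <= N by apply: le_trans (HN 0); apply: sumr_ge0.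
have ir0 : 0 <= r^-1 by rewrite invr_ge0 ltW.
have ip0 : 0 <= p^-1 by rewrite invr_ge0 ltW.
set A := \sum_(n < m.*2) _.
have key (j : 'I_m) :
   \sum_(i < m) a (i + j)%N * (b / q) ^+ (i + j) * \sum_(z <- Z) X i z * G j z
   <= (D `^ r^-1 * (fibre_const * K * A) `^ r^-1 * N `^ p^-1) * (b ^+ 2 / q) ^+ j.
  pose c i := a (i + j)%N.
  pose U z := \sum_(i < m) c i * ((b / q) ^+ i * X i z).
  have U0 z : 0 <= U z.
    by apply: sumr_ge0 => i _; rewrite /c mulr_ge0 // mulr_ge0 // ltW.
  have -> : \sum_(i < m) a (i + j)%N * (b / q) ^+ (i + j) *
      \sum_(z <- Z) X i z * G j z = (b / q) ^+ j * \sum_(z <- Z) G j z * U z.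
    rewrite mulr_sumr /U.
    under [RHS]eq_bigr => z _ do rewrite !mulr_sumr.
    rewrite [RHS]exchange_big /=; apply: eq_bigr => i _.
    by rewrite mulr_sumr; apply: eq_bigr => z _; rewrite exprD /c; ring.
  have q0j : 0 <= q ^+ j by rewrite exprn_ge0 // ltW.
  have GU : \sum_(z <- Z) G j z * U z <=
      D `^ r^-1 * b ^+ j * \sum_(z <- Z) H j z `^ p^-1 * U z.
    rewrite mulr_sumr; apply: ler_sum => z _; rewrite mulrA ler_wpM2r //.
    apply: le_trans (GH j z) _; rewrite powRM // (powR_exprn _ _ (ltW q0)).
    by rewrite -bq powRK ?gt_eqF ?(ltW b0).
  have HU : \sum_(z <- Z) H j z `^ p^-1 * U z <=
      N `^ p^-1 * (fibre_const * K * A) `^ r^-1.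
    apply: le_trans (hoelder_sum Z xpredT p0 r0 pr _ U0) _.
      by move=> z; exact: powR_ge0.
    apply: ler_pM; rewrite ?powR_ge0 //; apply: ler_powR2 => //.
    - by apply: sumr_ge0 => z _; exact: powR_ge0.
    - apply: le_trans (HN j); apply: ler_sum => z _.
      by rewrite powRVK ?gt_eqF.
    - by apply: sumr_ge0 => z _; exact: powR_ge0.
    apply: le_trans (fibre_sum (c := c) m _) _; first by move=> i; exact: a0.
    rewrite (ler_wpM2l (mulr_ge0 fibre_const_ge0 K0)) //.
    have -> : \sum_(i < m) c i `^ r = \sum_(j <= n < m + j) a n `^ r.
      by rewrite -{1}[j : nat]add0n big_addn addnK big_mkord.
    rewrite /A -(big_mkord xpredT (fun n => a n `^ r)).
    have jm2 : (m + j <= m.*2)%N by rewrite -addnn leq_add2l ltnW.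
    have j2 : (j <= m.*2)%N := leq_trans (leq_addl m j) jm2.
    rewrite (big_cat_nat (leq0n j) j2) (big_cat_nat (leq_addl m j) jm2) /=.
    rewrite addrCA lerDl addr_ge0 //; apply: sumr_ge0 => *; exact: powR_ge0.
  apply: le_trans (ler_wpM2l (ltW (weight_gt0 _)) GU) _.
  rewrite mulrA [(b / q) ^+ j * _]mulrC.
  rewrite [leRHS](_ : _ = (D `^ r^-1 * b ^+ j * (b / q) ^+ j) *
       (N `^ p^-1 * (fibre_const * K * A) `^ r^-1)); last first.
    have bbE : b ^+ j * (b / q) ^+ j = (b ^+ 2 / q) ^+ j.
      by rewrite -exprMn mulrA -expr2.
    by rewrite -(mulrA (D `^ r^-1) (b ^+ j)) bbE; ring.
  apply: ler_wpM2l HU.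
  by rewrite !mulr_ge0 ?powR_ge0 ?(ltW (weight_gt0 _)) ?exprn_ge0 ?(ltW b0).
apply: le_trans (ler_sum _ (fun j _ => key j)) _.
have A0 : 0 <= A by apply: sumr_ge0 => *; exact: powR_ge0.
rewrite -mulr_sumr (powRM _ (mulr_ge0 fibre_const_ge0 K0) A0) (powRM _ fibre_const_ge0 K0).
apply: le_trans (ler_wpM2l _ (geometric_le m ratio_ge0 ratio_lt1)) _.
  by rewrite !mulr_ge0 ?powR_ge0.
by rewrite /bilinear_const le_eqVlt; apply/orP; left; apply/eqP; ring.
Qed.
End Bilinear.
End Fibres.

(** * The convolution inequality on finite sets *)

Section RadialBilinear.
Variable k : nat.
Implicit Types (x y : free_group k) (z : seq (letter k)).

(** [z] is the [i]-th ancestor of [x], that is, [x] without its [i] first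
    letters; a word shorter than [i] has none. *)
Definition ancestor i z x := (i <= size (word x))%N && (drop i (word x) == z).

Lemma count_ancestor_le i z (X : seq (free_group k)) : (0 < k)%N -> uniq X ->
  (count (ancestor i z) X <= 2 * k.*2.-1 ^ i)%N.
Proof.
move=> k0 uX; case: (boolP (reduced z)) => rz; last first.
  rewrite (@eq_count _ _ pred0) ?count_pred0 // => x /=.
  apply/negbTE; apply: contra rz => /andP[_ /eqP <-].
  apply: (@reduced_catr k (take i (word x))).
  by rewrite cat_take_drop word_reduced.
apply: leq_trans (size_descendants_le i k0 rz).
rewrite -size_filter -(size_map val); apply: uniq_leq_size.
  by rewrite map_inj_uniq ?filter_uniq //; exact: val_inj.
move=> w /mapP[x]; rewrite mem_filter => /andP[az _] ->.
by rewrite mem_descendants // word_reduced.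
Qed.

Context {R : realType}.

Lemma sum_ancestor_le1 i x (Z : seq (seq (letter k))) : uniq Z ->
  \sum_(z <- Z) (ancestor i z x)%:R <= 1 :> R.
Proof.
move=> uZ; apply: (@le_trans _ _ (\sum_(z <- Z) (z == drop i (word x))%:R)).
  apply: ler_sum => z _; rewrite ler_nat /ancestor [z == _]eq_sym.
  by case: (i <= _)%N; case: (drop i (word x) == z).
rewrite -natr_sum -[(1 : R)]/(1%:R) ler_nat.
have := count_uniq_mem (drop i (word x)) uZ; rewrite -sum1_count big_mkcond /=.
have -> : (\sum_(z <- Z) (if z == drop i (word x) then 1 else 0) =
          \sum_(z <- Z) (z == drop i (word x)))%N.
  by apply: eq_bigr => z _; case: eqP.
by move=> ->; case: (_ \in _).
Qed.

Variables (p r b q : R).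
Hypotheses (p0 : 0 < p) (r2 : 2 < r) (pr : p^-1 + r^-1 = 1).
Hypotheses (k0 : (0 < k)%N) (b1 : 1 < b) (bq : b `^ r = q)
  (qE : q = (k.*2.-1)%:R).

(** The constant of [radial_bilinear]; a word has at most [2 * q ^+ i]
    descendants of order [i], whence the parameter [2]. *)
Definition radial_const := bilinear_const r q b 2.

(** The convolution inequality in its dual form, for finite sets [X] and [Y] and
    the radial kernel [a n * q ^ (- n / p)] on the sphere of radius [n]. *)
Lemma radial_bilinear (X Y : seq (free_group k)) (a : nat -> R)
    (g : free_group k -> R) (A : R) :
  uniq X -> uniq Y -> (forall n, 0 <= a n) -> (forall y, 0 <= g y) ->
  (forall m, \sum_(n < m) a n `^ r <= A) ->
  \sum_(x <- X) \sum_(y <- Y)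
    a (fg_length (x * y^-1)%g) * (b / q) ^+ fg_length (x * y^-1)%g * g y <=
  radial_const * (size X)%:R `^ r^-1 * (\sum_(y <- Y) g y `^ p) `^ p^-1 *
    A `^ r^-1.
Proof.
move=> uX uY a0 g0 aA.
have r0 : 0 < r by apply: lt_trans r2.
have b0 : 0 < b by exact: lt_trans b1.
have q0 : 0 < q by rewrite -bq powR_gt0.
pose F n := a n * (b / q) ^+ n.
have F0 n : 0 <= F n by rewrite mulr_ge0 // exprn_ge0 // divr_ge0 // ltW.
pose m := (\max_(x <- X ++ Y) size (word x)).+1.
have szX x : x \in X ++ Y -> (size (word x) < m)%N.
  by move=> xX; rewrite ltnS; exact: (@leq_bigmax_seq _ _ xpredT (fun x => size (word x))).
pose Z := undup [seq drop i (word x) | x <- X, i <- iota 0 m].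
have uZ : uniq Z by exact: undup_uniq.
pose N i z := \sum_(x <- X) (ancestor i z x)%:R : R.
pose G j z := \sum_(y <- Y | ancestor j z y) g y.
pose H j z := \sum_(y <- Y | ancestor j z y) g y `^ p.
have N0 i z : 0 <= N i z by apply: sumr_ge0 => *; rewrite ler0n.
have cntE i z (W : seq (free_group k)) :
    \sum_(x <- W) (ancestor i z x)%:R = (count (ancestor i z) W)%:R :> R.
  by rewrite -natr_sum -sum1_count [in RHS]big_mkcond.
have cntD i z W : uniq W -> (count (ancestor i z) W)%:R <= 2 * q ^+ i :> R.
  by move=> uW; rewrite qE -natrX -natrM ler_nat count_ancestor_le.
have ND i z : N i z <= 2 * q ^+ i by rewrite /N cntE cntD.
have NK i : \sum_(z <- Z) N i z <= (size X)%:R.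
  rewrite exchange_big /=.
  apply: le_trans (ler_sum _ (fun x _ => sum_ancestor_le1 i x uZ)) _.
  by rewrite big_const_seq count_predT iter_addr_0.
have G0 j z : 0 <= G j z by exact: sumr_ge0.
have H0 j z : 0 <= H j z by apply: sumr_ge0 => *; exact: powR_ge0.
have GH j z : G j z <= (2 * q ^+ j) `^ r^-1 * H j z `^ p^-1.
  have := hoelder_sum Y (ancestor j z) p0 r0 pr g0 (fun _ => ler01).
  under eq_bigr => y _ do rewrite mulr1.
  move/le_trans; apply; rewrite mulrC ler_wpM2r ?powR_ge0 //.
  have ir0 : 0 <= r^-1 by rewrite invr_ge0 ltW.
  under eq_bigr => y _ do rewrite powR1.
  apply: ler_powR2; rewrite ?sumr_ge0 //.
  by rewrite big_const_seq iter_addr_0 cntD.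
have HN j : \sum_(z <- Z) H j z <= \sum_(y <- Y) g y `^ p.
  have -> : \sum_(z <- Z) H j z =
      \sum_(y <- Y) (\sum_(z <- Z) (ancestor j z y)%:R) * g y `^ p.
    under [RHS]eq_bigr => y _ do rewrite mulr_suml.
    rewrite [RHS]exchange_big /=; apply: eq_bigr => z _.
    rewrite /H big_mkcond /=; apply: eq_bigr => y _.
    by case: (ancestor j z y); rewrite ?mul1r ?mul0r.
  apply: ler_sum => y _; rewrite -[leRHS]mul1r ler_wpM2r ?powR_ge0 //.
  exact: sum_ancestor_le1.
have H1 := bilinear_sum p0 r0 pr b1 bq (ler0n _ 2) N0 ND NK H0 GH HN r2 m a0.
have B0 : 0 <= bilinear_const r q b 2 by exact: bilinear_const_ge0.
move: H1; rewrite -/radial_const.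
set M := radial_const * _ * _ => H1.
have M0 : 0 <= M := mulr_ge0 (mulr_ge0 B0 (powR_ge0 _ _)) (powR_ge0 _ _).
apply: (@le_trans _ _ (M * (\sum_(n < m.*2) a n `^ r) `^ r^-1)); last first.
  apply: ler_wpM2l => //; apply: ler_powR2 => //.
    by rewrite invr_ge0 ltW.
  by apply: sumr_ge0 => *; exact: powR_ge0.
apply: le_trans H1; rewrite -/F.
have E i j : \sum_(z <- Z) N i z * G j z =
   \sum_(x <- X) \sum_(y <- Y)
     (\sum_(z <- Z) (ancestor i z x && ancestor j z y)%:R) * g y.
  rewrite /N; under eq_bigr => z _ do rewrite mulr_suml.
  rewrite exchange_big /=; apply: eq_bigr => x _.
  under [RHS]eq_bigr => y _ do rewrite mulr_suml.
  rewrite [RHS]exchange_big /=; apply: eq_bigr => z _.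
  rewrite /G big_mkcond mulr_sumr /=; apply: eq_bigr => y _.
  by case: (ancestor i z x); case: (ancestor j z y);
    rewrite ?mul1r ?mul0r ?mulr0.
under [leRHS]eq_bigr => j _.
  under eq_bigr => i _.
    rewrite E mulr_sumr.
    under eq_bigr => x _ do rewrite mulr_sumr.
    over.
  rewrite exchange_big /=.
  under eq_bigr => x _ do rewrite exchange_big /=.
  over.
rewrite [leRHS]exchange_big /= big_seq [leRHS]big_seq.
apply: ler_sum => x xX; rewrite [leRHS]exchange_big /= big_seq [leRHS]big_seq.
apply: ler_sum => y yY.
have [i [j [ix jy dxy ->]]] := fg_length_mulV x y.
have im : (i < m)%N by apply: leq_ltn_trans ix (szX _ _); rewrite mem_cat xX.
have jm : (j < m)%N by apply: leq_ltn_trans jy (szX _ _); rewrite mem_cat yY orbT.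
have T0 (j' i' : nat) : 0 <= a (i' + j')%N * (b / q) ^+ (i' + j') *
   ((\sum_(z <- Z) (ancestor i' z x && ancestor j' z y)%:R) * g y).
  apply: mulr_ge0; first exact: F0.
  by apply: mulr_ge0 => //; apply: sumr_ge0 => *; exact: ler0n.
(* Of the double sum over [i] and [j], the pair given by the longest common
   suffix suffices. *)
rewrite (bigD1 (Ordinal jm)) //= (bigD1 (Ordinal im)) //= -addrA.
apply: (@le_trans _ _ (a (i + j)%N * (b / q) ^+ (i + j) *
   ((\sum_(z <- Z) (ancestor i z x && ancestor j z y)%:R) * g y))); last first.
  rewrite lerDl addr_ge0 ?sumr_ge0 // => j' _; exact: sumr_ge0.
apply: ler_wpM2l; first exact: F0.
rewrite -[leLHS]mul1r; apply: ler_wpM2r => //.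
have zZ : drop i (word x) \in Z.
  by rewrite mem_undup; apply/allpairsPdep; exists x, i; rewrite mem_iota.
rewrite (big_rem _ zZ) /= /ancestor ix jy -dxy eqxx /= lerDl.
by apply: sumr_ge0 => *; exact: ler0n.
Qed.
End RadialBilinear.

(** * From finite sets to operator norms *)

Section Sums.
Context {R : realType} {T : choiceType}.
Implicit Types (a : T -> R) (h : T -> R[i]).

Lemma cabs_ge0 (z : R[i]) : 0 <= cabs z.
Proof. by case: z => x y; exact: sqrtr_ge0. Qed.

Lemma cabsM (z w : R[i]) : cabs (z * w) = cabs z * cabs w.
Proof. exact: ComplexField.Normc.normcM. Qed.

Lemma cabs_sum (I : Type) (s : seq I) (F : I -> R[i]) :
  cabs (\sum_(x <- s) F x) <= \sum_(x <- s) cabs (F x).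
Proof.
elim: s => [|x s IH].
  by rewrite !big_nil /cabs ComplexField.Normc.normc0.
rewrite !big_cons; apply: le_trans (le_normcD _ _) _.
by rewrite lerD2l.
Qed.

Lemma cabs_le_add (x y : R) : cabs (Complex x y) <= `|x| + `|y|.
Proof.
rewrite /cabs /= -[leRHS]ger0_norm ?addr_ge0 // -sqrtr_sqr.
rewrite ler_sqrt ?sqr_ge0 // sqrrD !real_normK ?num_real //.
by rewrite [leRHS]addrAC lerDl mulrn_wge0 // mulr_ge0.
Qed.

Lemma abs_Re_le (z : R[i]) : `|complex.Re z| <= cabs z.
Proof.
case: z => x y; rewrite /cabs /= -sqrtr_sqr ler_sqrt ?addr_ge0 ?sqr_ge0 //.
by rewrite lerDl sqr_ge0.
Qed.

Lemma abs_Im_le (z : R[i]) : `|complex.Im z| <= cabs z.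
Proof.
case: z => x y; rewrite /cabs /= -sqrtr_sqr ler_sqrt ?addr_ge0 ?sqr_ge0 //.
by rewrite lerDr sqr_ge0.
Qed.

Lemma esum_le_seq a (B : R) :
  (forall s : seq T, uniq s -> \sum_(x <- s) a x <= B) ->
  (\esum_(x in [set: T]) (a x)%:E <= B%:E)%E.
Proof.
move=> H; apply: ge_ereal_sup => _ [D [finD _] <-].
by rewrite fsbig_finite //= sumEFin lee_fin H.
Qed.

Lemma seq_le_esum a (s : seq T) : uniq s ->
  ((\sum_(x <- s) a x)%:E <= \esum_(x in [set: T]) (a x)%:E)%E.
Proof.
move=> us; apply: esum_ge; exists [set` [fset x in s]%fset].
  by split => //; exact: finite_fset.
rewrite fsbig_finite ?finite_fset //= set_fsetK sumEFin lee_fin le_eqVlt.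
apply/orP; left; apply/eqP/perm_big; apply: uniq_perm => //.
by move=> x; rewrite !inE.
Qed.

Lemma abs_real_sum_le a (B : R) :
  (\esum_(x in [set: T]) (`|a x|)%:E <= B%:E)%E -> `|real_sum a| <= B.
Proof.
move=> aB; rewrite /real_sum.
have bnd (u : T -> \bar R) : (forall x, 0 <= u x)%E ->
    (forall x, u x <= (`|a x|)%:E)%E ->
    exists2 c : R, 0 <= c <= B & esum [set: T] u = c%:E.
  move=> u0 ua; have e0 : (0 <= esum [set: T] u)%E by exact: esum_ge0.
  have eB : (esum [set: T] u <= B%:E)%E.
    by apply: le_trans aB; apply: le_esum.
  move: e0 eB; case: (esum _ _) => [c| |] //; rewrite !lee_fin => c0 cB.
  by exists c; rewrite ?c0.
have posa (x : T) : ((fun x => (a x)%:E)^\+%E x <= (`|a x|)%:E)%E.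
  by rewrite funeposE -EFin_max lee_fin ge_max normr_ge0 ler_norm.
have nega (x : T) : ((fun x => (a x)%:E)^\-%E x <= (`|a x|)%:E)%E.
  rewrite funenegE -EFinN -EFin_max lee_fin ge_max normr_ge0 andbT.
  by rewrite -normrN ler_norm.
have [c /andP[c0 cB] ->] := bnd _ (fun x => funepos_ge0 _ x) posa.
have [d /andP[d0 dB] ->] := bnd _ (fun x => funeneg_ge0 _ x) nega.
rewrite /= ler_norml; lra.
Qed.

Lemma cabs_complex_sum_le h (B : R) :
  (\esum_(x in [set: T]) (cabs (h x))%:E <= B%:E)%E ->
  cabs (complex_sum h) <= 2 * B.
Proof.
move=> hB; apply: le_trans (cabs_le_add _ _) _.
rewrite mulrDl mul1r lerD //; apply: abs_real_sum_le; apply: le_trans hB;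
  apply: le_esum => x _; rewrite lee_fin; [exact: abs_Re_le|exact: abs_Im_le].
Qed.

Lemma lp_norm_fin (p : R) h : 0 < p -> (lp_norm p h < +oo)%E ->
  exists2 G : R, 0 <= G &
    \esum_(x in [set: T]) (cabs (h x) `^ p)%:E = G%:E /\
    lp_norm p h = (G `^ p^-1)%:E.
Proof.
move=> p0; rewrite /lp_norm => H.
have e0 : (0 <= \esum_(x in [set: T]) (cabs (h x) `^ p)%:E)%E.
  by apply: esum_ge0 => x _; rewrite lee_fin powR_ge0.
have := lty_poweRy _ H; rewrite invr_eq0 lt0r_neq0 // => /(_ isT).
move: e0; case: (esum _ _) => [G| |] // G0 _; exists G => //.
Qed.
End Sums.

Section Upper.
Context {R : realType} {k : nat}.
Variables (p r b q : R).
Hypotheses (p0 : 0 < p) (r2 : 2 < r) (pr : p^-1 + r^-1 = 1).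
Hypotheses (k0 : (0 < k)%N) (b1 : 1 < b) (bq : b `^ r = q)
  (qE : q = (k.*2.-1)%:R) (rE : conj_exponent p = r).

Variables (a : nat -> R[i]) (A : R).
Hypothesis aA : forall m, \sum_(n < m) (cabs (a n) * (q / b) ^+ n) `^ r <= A.
Let f : free_group k -> R[i] := radial a.

Let r0 : 0 < r. Proof. exact: lt_trans r2. Qed.
Let b0 : 0 < b. Proof. exact: lt_trans b1. Qed.
Let q0 : 0 < q. Proof. by rewrite -bq powR_gt0. Qed.

Section Fixed_g.
Variables (g : free_group k -> R[i]) (G : R).
Hypotheses (G0 : 0 <= G)
  (gG : \esum_(x in [set: free_group k]) (cabs (g x) `^ p)%:E = G%:E).

(** The convolution inequality for [g] in l^p, absolute values inside. *)
Lemma conv_abs_bound (X : seq (free_group k)) : uniq X ->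
  (\sum_(x <- X) \esum_(y in [set: free_group k]) (cabs (conv_term f g x y))%:E
  <= (radial_const r b q * (size X)%:R `^ r^-1 * G `^ p^-1 * A `^ r^-1)%:E)%E.
Proof.
move=> uX; rewrite -esum_sum; last by move=> *; rewrite lee_fin cabs_ge0.
under eq_esum => y _ do rewrite sumEFin.
apply: esum_le_seq => Y uY.
pose c n := cabs (a n) * (q / b) ^+ n.
have c0 n : 0 <= c n.
  by rewrite mulr_ge0 ?cabs_ge0 // exprn_ge0 // divr_ge0 // ltW.
have h0 y : 0 <= cabs (g y) by exact: cabs_ge0.
have := radial_bilinear p0 r2 pr k0 b1 bq qE uX uY c0 h0 aA.
set S := \sum_(y <- Y) _ => H; rewrite exchange_big /=.
have SG : S <= G by rewrite -lee_fin -gG; exact: seq_le_esum.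
have B0 : 0 <= radial_const r b q by exact: bilinear_const_ge0.
apply: (@le_trans _ _ (radial_const r b q * (size X)%:R `^ r^-1 *
  S `^ p^-1 * A `^ r^-1)); last first.
  rewrite ler_wpM2r ?powR_ge0 // ler_wpM2l //.
    exact: mulr_ge0 B0 (powR_ge0 _ _).
  apply: ler_powR2 => //; first by rewrite invr_ge0 ltW.
  by apply: sumr_ge0 => *; exact: powR_ge0.
apply: le_trans H; apply: ler_sum => x _; apply: ler_sum => y _.
have cE n : c n * (b / q) ^+ n = cabs (a n).
  rewrite /c -mulrA -exprMn.
  have -> : q / b * (b / q) = 1 by rewrite mulrA divfK ?divff ?lt0r_neq0.
  by rewrite expr1n mulr1.
by rewrite cE /conv_term cabsM.
Qed.

(** Every [g] in l^p is in the domain of the convolution by [f]. *)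
Lemma conv_dom_lp : conv_dom f g.
Proof.
move=> x; rewrite /abs_summable /summable.
have := @conv_abs_bound [:: x] isT; rewrite big_seq1.
move=> /le_lt_trans /(_ (ltry _)); apply: le_lt_trans; apply: le_esum => y _.
by rewrite gee0_abs // lee_fin cabs_ge0.
Qed.

Lemma conv_weak_norm :
  (weak_norm p (conv f g) <=
    (2 * radial_const r b q * A `^ r^-1 * G `^ p^-1)%:E)%E.
Proof.
apply: ge_ereal_sup => _ [F F0 <-]; rewrite lee_fin rE.
have cF : 0 < #|` F|%:R `^ r^-1 :> R by rewrite powR_gt0 // ltr0n cardfs_gt0.
rewrite ler_pdivrMr //; apply: le_trans (cabs_sum _ _) _.
have e0 x : (0 <= \esum_(y in [set: free_group k]) (cabs (conv_term f g x y))%:E)%E.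
  by apply: esum_ge0 => y _; rewrite lee_fin cabs_ge0.
pose e x := fine (\esum_(y in [set: free_group k]) (cabs (conv_term f g x y))%:E).
have eE x : \esum_(y in [set: free_group k]) (cabs (conv_term f g x y))%:E = (e x)%:E.
  rewrite /e fineK // ge0_fin_numE //; have := conv_dom_lp x.
  rewrite /abs_summable /summable; apply: le_lt_trans; apply: le_esum => y _.
  by rewrite gee0_abs // lee_fin cabs_ge0.
have := @conv_abs_bound F (fset_uniq F).
under eq_bigr => x _ do rewrite eE.
rewrite sumEFin lee_fin => H.
apply: (@le_trans _ _ (2 * \sum_(x <- F) e x)).
  rewrite mulr_sumr; apply: ler_sum => x _.
  by apply: cabs_complex_sum_le; rewrite eE.
apply: le_trans (ler_wpM2l _ H) _ => //.
by rewrite le_eqVlt; apply/orP; left; apply/eqP; rewrite -/(#|` F|); ring.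
Qed.
End Fixed_g.

(** The factor [2] comes from bounding a complex sum by its real and imaginary
    parts. *)
Lemma lambda_norm_le :
  (lambda_norm p f <= (2 * radial_const r b q * A `^ r^-1)%:E)%E.
Proof.
have B0 : 0 <= radial_const r b q by exact: bilinear_const_ge0.
apply: ereal_inf_lbound; exists (2 * radial_const r b q * A `^ r^-1) => //.
split; first by rewrite mulr_ge0 ?powR_ge0 // mulr_ge0.
move=> g /(lp_norm_fin p0)[G G0 [gG ->]].
by split; [exact: conv_dom_lp gG|rewrite -EFinM; exact: conv_weak_norm gG].
Qed.
End Upper.

(** * Lorentz norms of radial functions *)

Section Spheres.
Variable k : nat.
Implicit Types (x y : free_group k).

(** The elements of length [n + |y|] whose [n]-th ancestor is [y]. *)
Definition fg_descendants n y : seq (free_group k) :=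
  pmap insub (descendants n (word y)).

Lemma mem_fg_descendants n y x : (x \in fg_descendants n y) =
  (n <= fg_length x)%N && (drop n (word x) == word y).
Proof.
by rewrite mem_pmap_sub mem_descendants ?word_reduced.
Qed.

Lemma fg_descendants_uniq n y : uniq (fg_descendants n y).
Proof. by apply: pmap_sub_uniq; exact: descendants_uniq. Qed.

Lemma size_fg_descendants n y :
  size (fg_descendants n y) = size (descendants n (word y)).
Proof.
rewrite size_pmap_sub; apply/eqP; rewrite -all_count; apply/allP => w.
by rewrite mem_descendants ?word_reduced // => /andP[].
Qed.

Definition sphere n : seq (free_group k) := fg_descendants n (fg_one k).

Lemma mem_sphere n x : (x \in sphere n) = (fg_length x == n).
Proof.
rewrite mem_fg_descendants /= -size_eq0 size_drop subn_eq0 eqn_leq andbC.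
by [].
Qed.

Lemma sphere_uniq n : uniq (sphere n).
Proof. exact: fg_descendants_uniq. Qed.

Lemma size_sphere_ge n : (k.*2.-1 ^ n <= size (sphere n))%N.
Proof. by rewrite size_fg_descendants size_descendants_ge. Qed.

Lemma size_sphere_le n : (0 < k)%N -> (size (sphere n) <= 2 * k.*2.-1 ^ n)%N.
Proof. by move=> k0; rewrite size_fg_descendants size_descendants_le. Qed.

(** The elements of length less than [n]. *)
Definition ball n : seq (free_group k) := flatten [seq sphere m | m <- iota 0 n].

Lemma mem_ball n x : (x \in ball n) = (fg_length x < n)%N.
Proof.
apply/flatten_mapP/idP => [[m]|xn].
  by rewrite mem_iota mem_sphere => /= mn /eqP ->.
by exists (fg_length x); rewrite ?mem_iota // mem_sphere.
Qed.

Lemma ball_uniq n : uniq (ball n).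
Proof.
elim: n => // n IH; rewrite /ball -[n.+1]addn1 iotaD map_cat flatten_cat /= cats0.
rewrite cat_uniq IH sphere_uniq andbT; apply/hasPn => x.
by rewrite add0n mem_sphere -/(ball n) mem_ball => /eqP ->; rewrite ltnn.
Qed.

Lemma size_ball_lt n : (2 <= k)%N -> (size (ball n) < k.*2.-1 ^ n)%N.
Proof.
move=> k2; elim: n => // n IH.
rewrite /ball -[n.+1]addn1 iotaD map_cat flatten_cat size_cat /= cats0 add0n.
have := @size_sphere_le n (ltnW k2); rewrite -/(ball n) expnD expn1.
have : (3 * k.*2.-1 ^ n <= k.*2.-1 ^ n * k.*2.-1)%N.
  by rewrite mulnC leq_mul2l -muln2; apply/orP; right; lia.
by lia.
Qed.
End Spheres.

Section Rearrangement.
Context {R : realType} {T : choiceType}.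
Implicit Types (h : T -> R[i]) (s : seq T).

Lemma le_counting (S : set T) s : uniq s -> {in s, forall x, S x} ->
  ((size s)%:R%:E <= counting S :> \bar R)%E.
Proof.
move=> us sS; rewrite /counting; case: asboolP => [fS|_]; last exact: leey.
rewrite lee_fin ler_nat; apply: uniq_leq_size => // x xs.
by rewrite in_fset_set // mem_set //; exact: sS.
Qed.

Lemma counting_le (S : set T) s : (forall x, S x -> x \in s) ->
  (counting S <= (size s)%:R%:E :> \bar R)%E.
Proof.
move=> Ss; have fS : finite_set S.
  by apply: (@sub_finite_set _ _ [set` s]) => //; exact: finite_seq.
rewrite /counting asboolT // lee_fin ler_nat; apply: uniq_leq_size => // x.
by rewrite in_fset_set // inE => /Ss.
Qed.

Lemma rearr_ge0 h j : (0 <= rearr h j)%E.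
Proof. by apply: le_ereal_inf_tmp => _ [t [t0 _] <-]; rewrite lee_fin. Qed.

(** If [|h| >= t] on at least [j] points, then [h^*(j) >= t]. *)
Lemma rearr_ge h j (t : R) s : uniq s -> (j <= size s)%N ->
  {in s, forall x, t <= cabs (h x)} -> (t%:E <= rearr h j)%E.
Proof.
move=> us js st; apply: le_ereal_inf_tmp => _ [t' [_ H] <-]; rewrite lee_fin leNgt.
apply/negP => t't; move: H; apply/negP; rewrite -leNgt.
apply: le_trans (le_counting us _); first by rewrite lee_fin ler_nat.
by move=> x /st /=; exact: lt_le_trans.
Qed.

(** If [|h| <= t] off fewer than [j] points, then [h^*(j) <= t]. *)
Lemma rearr_le h j (t : R) s : 0 <= t -> (size s < j)%N ->
  (forall x, x \notin s -> cabs (h x) <= t) -> (rearr h j <= t%:E)%E.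
Proof.
move=> t0 sj st; apply: ereal_inf_lbound; exists t => //; split => //.
apply: (@le_lt_trans _ _ (size s)%:R%:E); last by rewrite lte_fin ltr_nat.
apply: counting_le => x /= tx; apply: contraLR tx => /st; by rewrite -leNgt.
Qed.
End Rearrangement.

Lemma big_blocks (V : nmodType) (u : nat -> V) (Q m : nat) : (0 < Q)%N ->
  \sum_(1 <= j < Q ^ m) u j =
  \sum_(n < m) \sum_(Q ^ n <= j < Q ^ n.+1) u j.
Proof.
move=> Q0; elim: m => [|m IH]; first by rewrite big_geq // big_ord0.
rewrite big_ord_recr /= -IH -big_cat_nat ?expn_gt0 ?Q0 //.
by rewrite leq_pexp2l.
Qed.

Section Lorentz.
Context {R : realType} {k : nat}.
Variables (p r q : R).
Hypotheses (k2 : (2 <= k)%N) (r2 : 2 < r) (rp : r / p = r - 1)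
  (qE : q = (k.*2.-1)%:R).
Variable a : nat -> R[i].
Let f : free_group k -> R[i] := radial a.
Let Q := k.*2.-1.
Let v := q `^ (r - 2).
(* [w = q ^ (r - 1) = q ^ (r / p)]. *)
Let w := q * v.
Let al n := cabs (a n) `^ r.

(** The terms of the series defining the [r]-th power of the [(p, r)]-norm of
    the radial function [f] with coefficients [a]. *)
Definition lorentz_term j : \bar R :=
  ((j%:R `^ (r / p - 1))%:E * poweR (rearr f j) r)%E.

Let r0 : 0 < r. Proof. by apply: lt_trans r2. Qed.
Let Q3 : (3 <= Q)%N. Proof. by rewrite /Q -muln2; lia. Qed.
Let q3 : 3 <= q. Proof. by rewrite qE (ler_nat _ 3). Qed.
Let q0 : 0 < q. Proof. by apply: lt_le_trans q3. Qed.
Let v1 : 1 < v.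
Proof.
have -> : 1 = 1 `^ (r - 2) :> R by rewrite powR1.
 apply: gt0_ltr_powR; rewrite ?nnegrE ?(ltW q0) //.
  by rewrite subr_gt0.
by apply: lt_le_trans q3; rewrite (ltr_nat _ 1 3).
Qed.
Let v0 : 0 < v. Proof. exact: lt_trans v1. Qed.
Let w0 : 0 < w. Proof. exact: mulr_gt0. Qed.
Let w3 : 3 <= w.
Proof. by rewrite -[leLHS]mulr1; apply: ler_pM => //; exact: ltW. Qed.

Let expE : r / p - 1 = r - 2. Proof. by rewrite rp -addrA -opprD. Qed.

Let lorentz_term_ge0 j : (0 <= lorentz_term j)%E.
Proof. by rewrite mule_ge0 ?lee_fin ?powR_ge0 ?poweR_ge0. Qed.

Let powQ n : (Q ^ n)%:R `^ (r - 2) = v ^+ n :> R.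
Proof. by rewrite natrX powR_exprn // -qE. Qed.

Let r2' : 0 <= r - 2. Proof. by rewrite subr_ge0 ltW. Qed.

Lemma lorentz_term_ge n j : (0 < j <= Q ^ n)%N ->
  ((j%:R `^ (r - 2) * al n)%:E <= lorentz_term j)%E.
Proof.
move=> /andP[j0 jn]; rewrite /lorentz_term expE EFinM.
apply: lee_wpmul2l; first by rewrite lee_fin powR_ge0.
rewrite -poweR_EFin; apply: gt0_ler_poweR; rewrite ?(ltW r0) //.
- by rewrite in_itv /= leey lee_fin cabs_ge0.
- by rewrite in_itv /= leey rearr_ge0.
apply: (rearr_ge (sphere_uniq k n)).
  by apply: leq_trans jn (size_sphere_ge k n).
by move=> x; rewrite mem_sphere /f /radial => /eqP ->.
Qed.

Lemma lorentz_term_le n j (t : R) : (Q ^ n <= j)%N -> 0 <= t ->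
  (forall l, (n <= l)%N -> al l <= t) ->
  (lorentz_term j <= (j%:R `^ (r - 2) * t)%:E)%E.
Proof.
move=> nj t0 H; rewrite /lorentz_term expE EFinM.
apply: lee_wpmul2l; first by rewrite lee_fin powR_ge0.
have -> : t%:E = poweR (t `^ r^-1)%:E r.
  by rewrite poweR_EFin powRVK ?lt0r_neq0.
apply: gt0_ler_poweR; rewrite ?(ltW r0) //.
- by rewrite in_itv /= leey rearr_ge0.
- by rewrite in_itv /= leey lee_fin powR_ge0.
apply: (rearr_le (s := ball k n)); rewrite ?powR_ge0 //.
  by apply: leq_trans nj; exact: size_ball_lt.
move=> x; rewrite mem_ball -leqNgt => /H Hx.
rewrite -[leLHS](powRK (lt0r_neq0 r0) (cabs_ge0 _)).
by apply: ler_powR2 Hx; rewrite ?powR_ge0 // invr_ge0 ltW.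
Qed.

(** On the block of the [j] with [Q ^ n <= j < Q ^ n.+1], [f^*(j)] is at least
    [|a n.+1|], the sphere of radius [n.+1] having at least [Q ^ n.+1] elements. *)
Lemma block_ge n : ((al n.+1 * w ^+ n.+1)%:E <=
  (2 * v)%:E * \sum_(Q ^ n <= j < Q ^ n.+1) lorentz_term j)%E.
Proof.
apply: (@le_trans _ _ ((2 * v)%:E *
    \sum_(Q ^ n <= j < Q ^ n.+1) (v ^+ n * al n.+1)%:E)%E).
  rewrite sumEFin -EFinM lee_fin big_const_nat iter_addr_0 -[X in _ <= _ * X]mulr_natl.
  rewrite natrB ?leq_pexp2l //; last by apply: leq_trans Q3.
  rewrite !natrX -qE /w exprMn exprS [v ^+ n.+1]exprS.
  have qn0 : 0 <= q ^+ n by rewrite exprn_ge0 // ltW.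
  have e : q * q ^+ n <= 2 * (q * q ^+ n - q ^+ n).
    by have := q3; move: (q ^+ n) qn0 => x; nra.
  have y0 : 0 <= v * (v ^+ n * al n.+1).
    by rewrite mulr_ge0 ?mulr_ge0 ?exprn_ge0 ?powR_ge0 ?(ltW v0).
  rewrite [leLHS](_ : _ = (q * q ^+ n) * (v * (v ^+ n * al n.+1))); last by ring.
  rewrite [leRHS](_ : _ = (2 * (q * q ^+ n - q ^+ n)) * (v * (v ^+ n * al n.+1)));
    last by ring.
  exact: ler_wpM2r.
apply: lee_wpmul2l; first by rewrite lee_fin mulr_ge0 // ltW.
rewrite big_nat [leRHS]big_nat; apply: lee_sum => j /andP[j1 j2].
have jp : (0 < j)%N.
  by apply: leq_trans j1; rewrite expn_gt0 (leq_trans _ Q3).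
apply: le_trans (lorentz_term_ge (n := n.+1) _); last by rewrite jp ltnW.
rewrite lee_fin ler_wpM2r ?powR_ge0 // -powQ; apply: ler_powR2 => //.
by rewrite ler_nat.
Qed.

(** On the same block, [f^*(j)] is at most the supremum of the [|a l|] with
    [n <= l], the ball of the elements of length less than [n] having fewer than
    [Q ^ n] elements. *)
Lemma block_le n (t : R) : 0 <= t -> (forall l, (n <= l)%N -> al l <= t) ->
  (\sum_(Q ^ n <= j < Q ^ n.+1) lorentz_term j <= (w * (w ^+ n * t))%:E)%E.
Proof.
move=> t0 H.
apply: (@le_trans _ _ (\sum_(Q ^ n <= j < Q ^ n.+1) (v ^+ n.+1 * t)%:E)%E).
  rewrite big_nat [leRHS]big_nat; apply: lee_sum => j /andP[j1 j2].
  apply: le_trans (lorentz_term_le j1 t0 H) _.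
  rewrite lee_fin ler_wpM2r // -powQ; apply: ler_powR2 => //.
  by rewrite ler_nat ltnW.
rewrite sumEFin lee_fin big_const_nat iter_addr_0 -mulr_natl mulrA -exprS /w exprMn.
have y0 : 0 <= v ^+ n.+1 * t by rewrite mulr_ge0 // exprn_ge0 // ltW.
rewrite -[leRHS]mulrA; apply: ler_wpM2r => //.
by rewrite qE -natrX ler_nat leq_subr.
Qed.

(** In this lemma and in [lorentz_le_coef_sum], [al n * w ^+ n] is the [r]-th
    power of [|a n| q ^ (n / p)]. *)
Lemma coef_sum_le_lorentz (L : R) m :
  (\sum_(1 <= j <oo) lorentz_term j <= L%:E)%E ->
  \sum_(n < m) al n * w ^+ n <= (1 + 2 * v) * L.
Proof.
move=> HL; have part N : (\sum_(1 <= j < N) lorentz_term j <= L%:E)%E.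
  by apply: le_trans HL; apply: nneseries_lim_ge => n _ _.
have L0 : 0 <= L by have := part 0%N; rewrite big_geq.
have vL0 : 0 <= 2 * v * L by rewrite mulr_ge0 // mulr_ge0 // ltW.
case: m => [|m]; first by rewrite big_ord0 mulrDl mul1r addr_ge0.
rewrite big_ord_recl expr0 mulr1 mulrDl mul1r lerD //.
  rewrite -lee_fin; apply: le_trans (part 2%N).
  rewrite big_nat1; apply: le_trans (lorentz_term_ge (n := 0) _) => //.
  by rewrite lee_fin powR1 mul1r.
rewrite -lee_fin -sumEFin.
apply: (@le_trans _ _ ((2 * v)%:E * (\sum_(1 <= j < Q ^ m) lorentz_term j))%E).
  rewrite big_blocks; last by apply: leq_trans Q3.
  rewrite ge0_sume_distrr; last by move=> i _; apply: sume_ge0.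
  by apply: lee_sum => i _; exact: block_ge.
by rewrite [leRHS]EFinM; apply: lee_wpmul2l => //; rewrite lee_fin mulr_ge0 // ltW.
Qed.

Lemma geometric_tail l m :
  \sum_(n < m | (n <= l)%N) w ^+ n <= 2 * w ^+ l.
Proof.
have S l' : \sum_(n < l'.+1) w ^+ n <= 2 * w ^+ l'.
  elim: l' => [|l' IH]; first by rewrite big_ord1 expr0; lra.
  rewrite big_ord_recr /= exprS.
  have : 0 <= w ^+ l' by rewrite exprn_ge0 // ltW.
  by have := w3; move: (w ^+ l') IH => x; nra.
have wn0 n : 0 <= w ^+ n by rewrite exprn_ge0 // ltW.
elim: m => [|m IH]; first by rewrite big_ord0 mulr_ge0.
rewrite big_mkcond big_ord_recr /= -big_mkcond.
case: leqP => [ml|_]; last by rewrite addr0.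
apply: (@le_trans _ _ (2 * w ^+ m)); last first.
  rewrite ler_wpM2l // ler_weXn2l //; apply: le_trans w3.
  by rewrite (ler_nat _ 1 3).
apply: le_trans (S m); rewrite [leRHS]big_ord_recr lerD2r big_mkcond /=.
by apply: ler_sum => n _; case: ifP.
Qed.

Lemma lorentz_le_coef_sum (A : R) :
  (forall m, \sum_(n < m) al n * w ^+ n <= A) ->
  (\sum_(1 <= j <oo) lorentz_term j <= (4 * w * A)%:E)%E.
Proof.
move=> HA; have A0 : 0 <= A by have := HA 0%N; rewrite big_ord0.
have al0 n : 0 <= al n by exact: powR_ge0.
have wn0 n : 0 < w ^+ n by rewrite exprn_gt0.
have alA l : al l * w ^+ l <= A.
  apply: le_trans (HA l.+1); rewrite big_ord_recr /= lerDr.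
  by apply: sumr_ge0 => i _; rewrite mulr_ge0 // ltW.
have Qm0 : (0 < Q)%N by apply: leq_trans Q3.
suff part m : (\sum_(1 <= j < Q ^ m) lorentz_term j <= (4 * w * A)%:E)%E.
  apply: lime_le; first by apply: is_cvg_nneseries => n _ _.
  apply: nearW => N; apply: le_trans (part N).
  have NQ : (N <= Q ^ N)%N by apply/ltnW/ltn_expl/(leq_trans _ Q3).
  case: N NQ => [|N] NQ; first by rewrite big_geq // sume_ge0.
  rewrite [leRHS](big_cat_nat _ NQ) //= leeDl // sume_ge0 //.
(* [tau n] bounds the [al l] with [n <= l]: its second term takes care of
   [m <= l], since [al l <= A / w ^+ l]. *)
pose tau n := \sum_(l < m | (n <= l)%N) al l + A / w ^+ m.
have tau0 n : 0 <= tau n.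
  by rewrite addr_ge0 ?sumr_ge0 // divr_ge0 // ltW.
have tauP n l : (n <= l)%N -> al l <= tau n.
  move=> nl; have [lm|ml] := ltnP l m.
    rewrite /tau (bigD1 (Ordinal lm)) //= -addrA lerDl addr_ge0 ?sumr_ge0 //.
    by rewrite divr_ge0 // ltW.
  apply: (@le_trans _ _ (A / w ^+ m)); last by rewrite lerDr sumr_ge0.
  rewrite ler_pdivlMr //; apply: le_trans (alA l); apply: ler_wpM2l => //.
  rewrite ler_weXn2l // ltW //; apply: lt_le_trans w3; by rewrite (ltr_nat _ 1 3).
rewrite big_blocks //.
apply: (@le_trans _ _ (\sum_(n < m) (w * (w ^+ n * tau n))%:E)%E).
  by apply: lee_sum => n _; apply: block_le => // l; exact: tauP.
rewrite sumEFin lee_fin -mulr_sumr (_ : 4 * w * A = w * (2 * A + 2 * A)); last by ring.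
apply: ler_wpM2l; first exact: ltW.
under eq_bigr => n _ do rewrite mulrDr.
rewrite big_split /= lerD //.
  under eq_bigr => n _ do rewrite mulr_sumr.
  rewrite (exchange_big_dep xpredT) //=.
  apply: (@le_trans _ _ (\sum_(l < m) 2 * (al l * w ^+ l))); last first.
    by rewrite -mulr_sumr ler_wpM2l.
  apply: ler_sum => l _; rewrite -mulr_suml.
  rewrite [leRHS](_ : _ = (2 * w ^+ l) * al l); last by ring.
  by apply: ler_wpM2r => //; exact: geometric_tail.
have -> : \sum_(i < m) w ^+ i * (A / w ^+ m) = (\sum_(i < m) w ^+ i) * A / w ^+ m.
  by rewrite mulr_suml mulr_suml; apply: eq_bigr => i _; rewrite mulrA.
rewrite ler_pdivrMr // [leRHS]mulrAC; apply: ler_wpM2r => //.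
apply: le_trans (geometric_tail m m).
rewrite le_eqVlt; apply/orP; left; apply/eqP; apply: eq_bigl => n.
by rewrite ltnW.
Qed.
End Lorentz.

(** * The lower bound *)

Section Positive.
Context {R : realType} {T : choiceType}.

Lemma sum_le_subseq (t : T -> R) (s B : seq T) : uniq s -> uniq B ->
  (forall x, 0 <= t x) -> (forall x, x \in s -> x \notin B -> t x = 0) ->
  \sum_(x <- s) t x <= \sum_(x <- B) t x.
Proof.
move=> us uB t0 sB.
rewrite (bigID [pred x | x \in B]) /= [X in _ + X]big_seq_cond.
rewrite [X in _ + X]big1 ?addr0; last by move=> x /andP[]; exact: sB.
rewrite [leRHS](bigID [pred x | x \in s]) /= ler_wpDr ?sumr_ge0 //.
rewrite -big_filter -[leRHS]big_filter le_eqVlt; apply/orP; left; apply/eqP.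
apply/perm_big/uniq_perm; rewrite ?filter_uniq // => x.
by rewrite !mem_filter andbC.
Qed.

Lemma cabs_real (x : R) : 0 <= x -> cabs (x%:C)%C = x.
Proof. by move=> x0; rewrite /cabs /= expr0n addr0 sqrtr_sqr ger0_norm. Qed.

Lemma ge0_cabsE (z : R[i]) : 0 <= z -> z = (cabs z)%:C%C.
Proof. by move=> z0; rewrite -[LHS]ger0_norm. Qed.

(** The sum of a summable nonnegative family is at least its finite partial
    sums. *)
Lemma complex_sum_ge0 (t : T -> R) : (forall x, 0 <= t x) ->
  abs_summable (fun x => (t x)%:C%C) ->
  exists S : R, complex_sum (fun x => (t x)%:C%C) = S%:C%C /\
    forall s, uniq s -> \sum_(x <- s) t x <= S.
Proof.
move=> t0; rewrite /abs_summable /summable.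
under eq_esum => x _ do rewrite cabs_real // gee0_abs ?lee_fin //.
move=> tfin.
have e0 : (0 <= \esum_(x in [set: T]) (t x)%:E)%E.
  by apply: esum_ge0 => x _; rewrite lee_fin.
have := seq_le_esum t; move: e0 tfin.
case E : (\esum_(x in [set: T]) (t x)%:E) => [S| |] // _ _ H.
exists S; split; last by move=> s us; rewrite -lee_fin; exact: H.
rewrite /complex_sum /real_sum /=.
have -> : esum [set: T] (fun x => (t x)%:E)^\+%E = S%:E.
  rewrite -E; apply: eq_esum => x _; rewrite funeposE; apply/max_idPl.
  by rewrite lee_fin.
have -> : esum [set: T] (fun x => (t x)%:E)^\-%E = 0%E.
  apply: esum1 => x _; rewrite funenegE; apply/max_idPr.
  by rewrite -EFinN lee_fin oppr_le0.
have -> : esum [set: T] (fun x : T => 0%:E : \bar R)^\+%E = 0%E.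
  by apply: esum1 => x _; rewrite funeposE maxxx.
have -> : esum [set: T] (fun x : T => 0%:E : \bar R)^\-%E = 0%E.
  by apply: esum1 => x _; rewrite funenegE oppe0 maxxx.
by rewrite /= !subr0.
Qed.
End Positive.

Section Lower.
Context {R : realType} {k : nat}.
Variables (p r q : R).
Hypotheses (k2 : (2 <= k)%N) (p0 : 0 < p) (r0 : 0 < r)
  (pr : p^-1 + r^-1 = 1) (qE : q = (k.*2.-1)%:R) (rE : conj_exponent p = r).
Variables (a : nat -> R[i]) (M : R).
Let f : free_group k -> R[i] := radial a.
Hypotheses (f0 : forall x, 0 <= f x) (M0 : 0 <= M).
Hypothesis HM : forall g, (lp_norm p g < +oo)%E ->
  conv_dom f g /\ (weak_norm p (conv f g) <= M%:E * lp_norm p g)%E.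

Let Q := k.*2.-1.
Let Q0 : (0 < Q)%N. Proof. by rewrite /Q -muln2; lia. Qed.
Let q0 : 0 < q. Proof. by rewrite qE ltr0n. Qed.
Let al n := cabs (a n).
Let w := q `^ (r - 1).

Let al0 n : 0 <= al n. Proof. exact: cabs_ge0. Qed.

Let fE x : f x = (al (fg_length x))%:C%C.
Proof. by rewrite (ge0_cabsE (f0 x)). Qed.

Section Fixed_N.
Variable N : nat.

(* The test function [t] is [ga l] on the sphere of radius [l <= N]; the base of
   the power [ga l] is, up to a factor of at most [2], the l^1 norm of [f] on the
   sphere of radius [N - l]. *)
Let ga l := (al (N - l) * q ^+ (N - l)) `^ (r - 1).
Let t (x : free_group k) : R :=
  if (fg_length x <= N)%N then ga (fg_length x) else 0.
Let A := \sum_(n < N.+1) al n `^ r * w ^+ n.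

Let ga0 l : 0 <= ga l. Proof. exact: powR_ge0. Qed.
Let t0 x : 0 <= t x. Proof. by rewrite /t; case: ifP. Qed.
Let A0 : 0 <= A.
Proof.
by apply: sumr_ge0 => n _; rewrite mulr_ge0 ?powR_ge0 // exprn_ge0 // powR_ge0.
Qed.

Let term_al n : (al n * q ^+ n) `^ r = q ^+ n * (al n `^ r * w ^+ n).
Proof.
have qr : q `^ r = q * w by rewrite /w mulr_powRB1 // ltW.
rewrite powRM // ?exprn_ge0 ?(ltW q0) // powR_exprn ?(ltW q0) // qr exprMn.
by rewrite mulrCA.
Qed.

Let radial_sum (F : nat -> R) :
  \sum_(y <- ball k N.+1) F (fg_length y) =
  \sum_(l < N.+1) (size (sphere k l))%:R * F l.
Proof.
rewrite /ball big_flatten big_map -[iota 0 N.+1]/(index_iota 0 N.+1) big_mkord.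
apply: eq_bigr => l _; rewrite (eq_big_seq (fun=> F l)) /=.
  by rewrite big_const_seq count_predT iter_addr_0 mulr_natl.
by move=> y; rewrite mem_sphere => /eqP ->.
Qed.

(* The test function has [\sum_y t y ^ p <= 2 q ^ N A]. *)
Let test_lp : (\esum_(y in [set: free_group k]) (cabs (t y)%:C%C `^ p)%:E <=
  (2 * q ^+ N * A)%:E)%E.
Proof.
apply: esum_le_seq => s us.
have E y : cabs (t y)%:C%C `^ p =
   if (fg_length y <= N)%N then (ga (fg_length y)) `^ p else 0.
  by rewrite cabs_real // /t; case: ifP => // _; rewrite powR0 // lt0r_neq0.
under eq_bigr => y _ do rewrite E.
apply: le_trans (sum_le_subseq (B := ball k N.+1) us (ball_uniq k _) _ _) _.
- by move=> y; case: ifP => // _; exact: powR_ge0.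
- by move=> y _; rewrite mem_ball ltnS => /negbTE ->.
rewrite (radial_sum (fun l => if (l <= N)%N then ga l `^ p else 0)).
rewrite /A mulr_sumr [leRHS](reindex_inj rev_ord_inj) /=.
apply: ler_sum => l _; have lN : (l <= N)%N by rewrite -ltnS.
rewrite lN subSS /ga -powRrM (conj_mulr p0 r0 pr) term_al.
have -> : 2 * q ^+ N = 2 * q ^+ l * q ^+ (N - l).
  by rewrite -mulrA -exprD subnKC.
rewrite -[leRHS]mulrA; apply: ler_wpM2r.
  by rewrite !mulr_ge0 ?powR_ge0 ?exprn_ge0 ?powR_ge0 ?(ltW q0).
by rewrite qE -natrX -natrM ler_nat size_sphere_le // ltnW.
Qed.

(* Its convolution by [f] has mass at least [q ^ N A] on the sphere of radius [N]:
   an element [y] of length [l] has at least [q ^ (N - l)] descendants [x] there,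
   and [|x y^-1| = N - l] for these. *)
Let test_conv : q ^+ N * A <=
  \sum_(x <- sphere k N) \sum_(y <- ball k N.+1) al (fg_length (x * y^-1)%g) * t y.
Proof.
rewrite exchange_big /=.
apply: (@le_trans _ _ (\sum_(y <- ball k N.+1)
   q ^+ (N - fg_length y) * al (N - fg_length y)%N * ga (fg_length y))).
  rewrite (radial_sum (fun l => q ^+ (N - l) * al (N - l)%N * ga l)).
  rewrite /A mulr_sumr [leLHS](reindex_inj rev_ord_inj) /=.
  apply: ler_sum => l _; have lN : (l <= N)%N by rewrite -ltnS.
  rewrite subSS /ga (mulrC (q ^+ (N - l))) mulr_powRB1 //; last first.
    by rewrite mulr_ge0 // exprn_ge0 // ltW.
  have -> : q ^+ N = q ^+ l * q ^+ (N - l) by rewrite -exprD subnKC.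
  rewrite -mulrA -term_al; apply: ler_wpM2r; first exact: powR_ge0.
  by rewrite qE -natrX ler_nat size_sphere_ge.
rewrite big_seq [leRHS]big_seq; apply: ler_sum => y; rewrite mem_ball ltnS => yN.
rewrite -mulr_suml /t yN; apply: ler_wpM2r => //.
set l := fg_length y in yN *.
apply: (@le_trans _ _ (\sum_(x <- fg_descendants (N - l) y) al (fg_length (x * y^-1)%g))).
  apply: (@le_trans _ _ (\sum_(x <- fg_descendants (N - l) y) al (N - l)%N)).
    rewrite big_const_seq count_predT iter_addr_0 -mulr_natl.
    apply: ler_wpM2r => //; rewrite qE -natrX ler_nat size_fg_descendants.
    by rewrite size_descendants_ge // word_reduced.
  rewrite big_seq [leRHS]big_seq; apply: ler_sum => x.
  rewrite mem_fg_descendants => /andP[lx /eqP dx].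
  rewrite (@fg_mul_cat _ _ _ (take (N - l) (word x))).
    by rewrite size_takel.
  by rewrite -dx cat_take_drop.
apply: sum_le_subseq => //; [exact: fg_descendants_uniq|exact: sphere_uniq|].
move=> x; rewrite mem_fg_descendants mem_sphere => /andP[lx /eqP dx] /negP[].
rewrite /fg_length -(cat_take_drop (N - l) (word x)) size_cat dx size_takel //.
by rewrite -/(fg_length y) subnK.
Qed.

(** If [M] is a bound for the operator norm, then comparing [test_lp] and
    [test_conv] gives [A <= 2 M A ^ (1 / p)], because the sphere of radius [N]
    has between [q ^ N] and [2 q ^ N] elements. *)
Lemma coef_sum_le_opnorm : A <= (2 * M) `^ r.
Proof.
pose g x : R[i] := (t x)%:C%C.
have glp : (lp_norm p g <= ((2 * q ^+ N * A) `^ p^-1)%:E)%E.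
  rewrite /lp_norm -poweR_EFin; apply: gt0_ler_poweR.
  - by rewrite invr_ge0 ltW.
  - by rewrite in_itv /= leey esum_ge0 // => x _; rewrite lee_fin powR_ge0.
  - rewrite in_itv /= leey lee_fin mulr_ge0 // mulr_ge0 // exprn_ge0 //.
    exact: ltW.
  - exact: test_lp.
have [gdom gM] := HM (le_lt_trans glp (ltry _)).
have convE x : exists S : R, conv f g x = S%:C%C /\
    \sum_(y <- ball k N.+1) al (fg_length (x * y^-1)%g) * t y <= S.
  have tE : conv_term f g x = fun y => (al (fg_length (x * y^-1)%g) * t y)%:C%C.
    by apply: funext => y; rewrite /conv_term fE /g -rmorphM.
  have tx0 y : 0 <= al (fg_length (x * y^-1)%g) * t y by exact: mulr_ge0.
  have [|S [S1 S2]] := complex_sum_ge0 tx0; first by rewrite -tE; exact: gdom.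
  by exists S; rewrite /conv tE S1; split => //; apply: S2; exact: ball_uniq.
have [S SP] := choice convE.
have S0 x : 0 <= S x.
  have [_] := SP x; apply: le_trans; apply: sumr_ge0 => y _; exact: mulr_ge0.
pose F := [fset x in sphere k N]%fset.
have FE : perm_eq F (sphere k N).
  by apply: uniq_perm; rewrite ?sphere_uniq ?fset_uniq // => x; rewrite !inE.
have szF : #|` F| = size (sphere k N) by exact: (perm_size FE).
have sN0 : (0 < size (sphere k N))%N.
  by apply: leq_trans (size_sphere_ge k N); rewrite expn_gt0 Q0.
have F0 : F != fset0 by rewrite -cardfs_gt0 szF.
have : ((cabs (\sum_(x <- F) conv f g x) / (#|` F|%:R `^ (conj_exponent p)^-1))%:E
   <= weak_norm p (conv f g))%E.
  by apply: ereal_sup_ubound; exists F.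
rewrite rE => /le_trans /(_ gM).
have := lee_wpmul2l (_ : 0 <= M%:E)%E glp; rewrite lee_fin => /(_ M0) gM'.
move=> /le_trans /(_ gM'); rewrite -EFinM lee_fin.
have -> : \sum_(x <- F) conv f g x = (\sum_(x <- sphere k N) S x)%:C%C.
  rewrite (perm_big _ FE) /= rmorph_sum; apply: eq_bigr => x _.
  by have [] := SP x.
rewrite cabs_real; last by apply: sumr_ge0.
rewrite szF ler_pdivrMr; last by rewrite powR_gt0 // ltr0n.
have low : q ^+ N * A <= \sum_(x <- sphere k N) S x.
  apply: le_trans test_conv _; apply: ler_sum => x _; by have [] := SP x.
move=> /(le_trans low) H.
have qN0 : 0 < q ^+ N by rewrite exprn_gt0.
have ir0 : 0 <= r^-1 by rewrite invr_ge0 ltW.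
have sz : (size (sphere k N))%:R `^ r^-1 <= (2 * q ^+ N) `^ r^-1.
  apply: ler_powR2 => //; rewrite qE -natrX -natrM ler_nat.
  by rewrite size_sphere_le // ltnW.
have H2 : q ^+ N * A <= (q ^+ N) * (2 * M * A `^ p^-1).
  apply: le_trans H _; apply: le_trans (ler_wpM2l _ sz) _.
    by rewrite mulr_ge0 ?powR_ge0.
  have qq0 : 0 <= 2 * q ^+ N by rewrite mulr_ge0 // ltW.
  rewrite powRM // [leLHS](_ : _ = ((2 * q ^+ N) `^ p^-1 * (2 * q ^+ N) `^ r^-1)
      * (M * A `^ p^-1)); last by ring.
  rewrite -powRD; last by rewrite pr oner_eq0.
  by rewrite pr powRr1 // le_eqVlt; apply/orP; left; apply/eqP; ring.
rewrite ler_pM2l // in H2.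
have [AE|An0] := eqVneq A 0; first by rewrite AE powR_ge0.
have Ap : 0 < A by rewrite lt0r An0 A0.
have AE : A = A `^ r^-1 * A `^ p^-1.
  by rewrite -powRD addrC pr ?powRr1 // oner_eq0.
rewrite {1}AE ler_pM2r ?powR_gt0 // in H2.
rewrite -[leLHS](powRVK (lt0r_neq0 r0) A0).
by apply: ler_powR2 H2; rewrite ?powR_ge0 // ltW.
Qed.
End Fixed_N.
End Lower.

(** * Weak-type norms of radial convolutors *)

Theorem theorem4 (R : realType) (k : nat) (hk : (2 <= k)%N) (p : R)
    (hp1 : 1 < p) (hp2 : p < 2) :
  exists C c : R, 0 < C /\ 0 < c /\
    forall (a : nat -> R[i]) (f : free_group k -> R[i]), f = radial a ->
      (lambda_norm p f <= C%:E * lorentz_norm p (conj_exponent p) f)%E /\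
      ((forall x : free_group k, 0 <= f x) ->
        (c%:E * lorentz_norm p (conj_exponent p) f <= lambda_norm p f)%E).
Proof.
set r := conj_exponent p.
have p0 : 0 < p by apply: lt_trans hp1.
have pm0 : 0 < p - 1 by rewrite subr_gt0.
have r2 : 2 < r by rewrite /r /conj_exponent ltr_pdivlMr //; lra.
have r0 : 0 < r by apply: lt_trans r2.
have pr : p^-1 + r^-1 = 1.
  by rewrite /r /conj_exponent invf_div -{1}[p^-1]mul1r -mulrDl subrKC divff ?lt0r_neq0.
have rp : r / p = r - 1 := conj_div p0 r0 pr.
have k0 : (0 < k)%N by apply: leq_trans hk.
pose q : R := (k.*2.-1)%:R.
have q1 : 1 < q by rewrite (ltr_nat _ 1) -muln2; lia.
have q0 : 0 < q by apply: lt_trans q1.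
pose b := q `^ r^-1.
have bq : b `^ r = q by rewrite powRVK ?lt0r_neq0 ?(ltW q0).
have b1 : 1 < b.
  have -> : 1 = 1 `^ r^-1 :> R by rewrite powR1.
  by apply: gt0_ltr_powR; rewrite ?invr_gt0 ?nnegrE ?(ltW q0).
have b0 : 0 < b by apply: lt_trans b1.
pose v := q `^ (r - 2).
pose w := q * v.
have v0 : 0 < v by rewrite powR_gt0.
have w0 : 0 < w by rewrite mulr_gt0.
have wE : q `^ (r - 1) = w.
  rewrite /w /v (_ : r - 2 = (r - 1) - 1); last by ring.
  by rewrite mulr_powRB1 ?(ltW q0) // subr_gt0; apply: lt_trans r2; rewrite (ltr_nat _ 1 2).
have qbE : (q / b) `^ r = w.
  apply: (mulIf (lt0r_neq0 q0)); rewrite -{2}bq -powRM ?divr_ge0 ?(ltW b0) ?(ltW q0) //.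
  rewrite divfK ?lt0r_neq0 // -wE mulrC mulr_powRB1 //; exact: ltW.
pose C := 2 * @radial_const R r b q * (1 + 2 * v) `^ r^-1.
have rc0 : 0 <= radial_const r b q := bilinear_const_ge0 2 b1 bq r2.
have C0 : 0 <= C := mulr_ge0 (mulr_ge0 (ler0n _ 2) rc0) (powR_ge0 _ _).
pose D := 2 * (4 * w) `^ r^-1.
have D0 : 0 < D by rewrite mulr_gt0 // powR_gt0 // mulr_gt0.
have ir0 : r^-1 != 0 by rewrite invr_eq0 lt0r_neq0.
(* [C] is only known to be nonnegative, and the first constant has to be positive,
   also for [C * +oo] to be [+oo] when the Lorentz norm is infinite. *)
exists (C + 1), D^-1; split; first by rewrite ltr_wpDl.
split; first by rewrite invr_gt0.
move=> a f ->{f}; have lE : lorentz_norm p r (radial a : free_group k -> R[i]) =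
    poweR (\sum_(1 <= j <oo) lorentz_term (k := k) p r a j)%E r^-1 by [].
have L0 : (0 <= \sum_(1 <= j <oo) lorentz_term (k := k) p r a j)%E.
  apply: nneseries_ge0 => j _ _.
  by rewrite mule_ge0 ?poweR_ge0 // lee_fin powR_ge0.
split=> [|f0].
  rewrite lE; move: L0; case E : (\sum_(1 <= j <oo) _)%E => [L| |] // L0; last first.
    by rewrite poweRyr // gt0_muley ?leey // lte_fin ltr_wpDl.
  rewrite poweR_EFin -EFinM.
  have HL : (\sum_(1 <= j <oo) lorentz_term (k := k) p r a j <= L%:E)%E.
    by rewrite E.
  have H m := coef_sum_le_lorentz hk r2 rp (erefl q) m HL.
  have aA m : \sum_(n < m) (cabs (a n) * (q / b) ^+ n) `^ r <= (1 + 2 * v) * L.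
    apply: le_trans (H m); rewrite le_eqVlt; apply/orP; left; apply/eqP.
    apply: eq_bigr => n _; rewrite powRM ?cabs_ge0 ?exprn_ge0 ?divr_ge0 ?(ltW b0) ?(ltW q0) //.
    by rewrite powR_exprn ?qbE // divr_ge0 // ltW.
  apply: le_trans (lambda_norm_le p0 r2 pr k0 b1 bq (erefl q) (erefl r) aA) _.
  rewrite lee_fin powRM //; last by rewrite addr_ge0 // mulr_ge0 // ltW.
  by rewrite mulrA -/C mulrDl mul1r lerDl powR_ge0.
apply: le_ereal_inf_tmp => _ [M [M0 HM] <-].
have coefM m : \sum_(n < m) cabs (a n) `^ r * w ^+ n <= (2 * M) `^ r.
  rewrite -wE; case: m => [|N]; first by rewrite big_ord0 powR_ge0.
  exact: (coef_sum_le_opnorm hk p0 r0 pr (erefl q) (erefl r) f0 M0 HM).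
have LM := lorentz_le_coef_sum (p := p) hk r2 rp (erefl q) coefM.
have M2 : 0 <= 2 * M by rewrite mulr_ge0.
have : (lorentz_norm p r (radial a : free_group k -> R[i]) <= (D * M)%:E)%E.
  have -> : (D * M)%:E = poweR (4 * w * (2 * M) `^ r)%:E r^-1.
    have w4 : 0 <= 4 * w by rewrite mulr_ge0 // ltW.
    rewrite poweR_EFin (powRM _ w4 (powR_ge0 _ _)) (powRK (lt0r_neq0 r0) M2).
    by rewrite /D mulrA [_ * 2]mulrC.
  rewrite lE; apply: gt0_ler_poweR LM.
  - by rewrite invr_ge0 ltW.
  - by rewrite in_itv /= leey L0.
  - by rewrite in_itv /= leey lee_fin !mulr_ge0 ?powR_ge0 ?(ltW w0).
move/(lee_wpmul2l (_ : 0 <= D^-1%:E)%E); rewrite lee_fin invr_ge0 ltW // => /(_ isT).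
by move/le_trans; apply; rewrite -EFinM lee_fin mulKf // lt0r_neq0.
Qed.
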